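(* Let $A$ be a non-selfinjective Nakayama algebra with $n$ simple modules (up to isomorphism). Then: (1) $\operatorname{sdomdim}(A) \leq 2n-2$. (2) $\operatorname{domdim}(A) \leq \dfrac{2n-2}{\operatorname{Def}(A)}$. (3) If $A$ has dominant dimension $\operatorname{domdim}(A)\geq n$, then $\operatorname{Def}(A)=1$.
   Context: All algebras are finite dimensional quiver algebras $KQ/I$ ($K$ a field, $I$ an admissible ideal), connected and non-semisimple; all modules are finitely generated right modules. A Nakayama algebra with $n$ simple modules is such an algebra whose quiver $Q$ is either the line $0\to 1\to\dots\to n-1$ or the oriented cycle $0\to1\to\dots\to n-1\to 0$ (equivalently, every indecomposable left or right projective module is uniserial). The dominant dimension $\operatorname{domdim}(M)$ of a module $M$ with minimal injective coresolution $0\to M\to I_0\to I_1\to\cdots$ is $0$ if $I_0$ is not projective, and $\sup\{k \mid I_i \text{ is projective for } i=0,\dots,k\}+1$ if $I_0$ is projective. The dominant dimension $\operatorname{domdim}(A)$ of the algebra is the dominant dimension of the regular module $A_A$. The defect $\operatorname{Def}(A)$ is the number of isomorphism classes of indecomposable injective non-projective $A$-modules. The super dominant dimension $\operatorname{sdomdim}(A)$ is the sum of the dominant dimensions of all (isomorphism classes of) indecomposable projective non-injective $A$-modules. *)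

(* Defs.v *)
From HB Require Import structures.
From mathcomp Require Import all_boot all_order all_algebra all_field.
From mathcomp Require Import finmap.
From mathcomp Require Import boolp classical_sets reals constructive_ereal ereal.
(* The notations of monalg clash with those of classical_sets. *)
From mathcomp Require Import -(notations) monalg.

Set Implicit Arguments.
Unset Strict Implicit.
Unset Printing Implicit Defensive.

Import Order.TTheory GRing.Theory Num.Theory.

Local Open Scope ring_scope.

(** * Quivers and path algebras *)

Record quiver := Quiver {
  vertex : finType;
  arrow : finType;
  source : arrow -> vertex;
  target : arrow -> vertex }.

Section Paths.
Variable Q : quiver.

Fixpoint walk (v : vertex Q) (s : seq (arrow Q)) : bool :=
  if s is a :: s' then (source a == v) && walk (target a) s' else true.

(* The starting vertex is part of the data, so that every vertex has its own
   path of length 0. *)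
Record qpath := QPath {
  qpath_val :> vertex Q * seq (arrow Q);
  _ : walk qpath_val.1 qpath_val.2 }.

HB.instance Definition _ := [isSub for qpath_val].
HB.instance Definition _ := [Choice of qpath by <:].

Definition psrc (p : qpath) : vertex Q := p.1.
Definition ptgt (p : qpath) : vertex Q := last p.1 (map (@target Q) p.2).
Definition plen (p : qpath) : nat := size p.2.

Definition trivial_path (v : vertex Q) : qpath := @QPath (v, [::]) isT.

(* First p, then q; None when they cannot be composed. *)
Definition pcomp (p q : qpath) : option qpath :=
  if ptgt p == psrc q then insub (p.1, p.2 ++ q.2) else None.

Lemma walk_cat v s t :
  walk v (s ++ t) = walk v s && walk (last v (map (@target Q) s)) t.
Proof. by elim: s v => //= a s IH v; rewrite IH andbA. Qed.

Lemma pcompP p q : ptgt p = psrc q ->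
  exists r, [/\ pcomp p q = Some r, r.1 = p.1 & r.2 = p.2 ++ q.2].
Proof.
move=> e; rewrite /pcomp e eqxx.
have w : walk p.1 (p.2 ++ q.2).
  rewrite walk_cat; apply/andP; split; first by case: (p).
  by rewrite -/(ptgt p) e; case: (q).
case: insubP => [r _ er|]; last by rewrite w.
by exists r; split=> //; rewrite -[qpath_val r]/(val r) er.
Qed.

Lemma pcompN p q : ptgt p <> psrc q -> pcomp p q = None.
Proof. by rewrite /pcomp; case: eqP. Qed.

Lemma pcompA p q r :
  obind (pcomp p) (pcomp q r) = obind (pcomp^~ r) (pcomp p q).
Proof.
have [e1|n1] := eqVneq (ptgt p) (psrc q); have [e2|n2] := eqVneq (ptgt q) (psrc r).
- have [pq [-> s1 t1]] := pcompP e1; have [qr [-> s2 t2]] := pcompP e2 => /=.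
  have f1 : ptgt p = psrc qr by rewrite e1 /psrc s2.
  have f2 : ptgt pq = psrc r.
    by rewrite -e2 /ptgt s1 t1 map_cat last_cat -/(ptgt p) e1.
  have [x [-> a1 b1]] := pcompP f1; have [y [-> a2 b2]] := pcompP f2.
  congr Some; apply: val_inj; case: x y a1 b1 a2 b2 => [[x1 x2] ?] [[y1 y2] ?] /=.
  by move=> -> -> -> ->; rewrite s1 t1 t2 catA.
- rewrite (pcompN (elimN eqP n2)); have [pq [-> s1 t1]] := pcompP e1.
  rewrite /= pcompN // => h; move/eqP: n2; apply; rewrite -h.
  by rewrite /ptgt s1 t1 map_cat last_cat -/(ptgt p) e1.
- rewrite (pcompN (elimN eqP n1)); have [qr [-> s2 t2]] := pcompP e2.
  by rewrite /= pcompN // => h; move/eqP: n1; apply; rewrite h /psrc s2.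
- by rewrite (pcompN (elimN eqP n1)) (pcompN (elimN eqP n2)).
Qed.

Lemma pcomp1 v q : pcomp (trivial_path v) q = if v == psrc q then Some q else None.
Proof.
rewrite /pcomp /ptgt /=; case: eqP => // ->.
case: q => [[a s] w] /=; case: insubP => [r _ er|]; last by rewrite w.
by congr Some; apply: val_inj; rewrite er.
Qed.

Lemma pcomp1r p v : pcomp p (trivial_path v) = if v == ptgt p then Some p else None.
Proof.
rewrite /pcomp /psrc /= eq_sym; case: eqP => // _.
case: p => [[a s] w] /=; rewrite cats0.
case: insubP => [r _ er|]; last by rewrite w.
by congr Some; apply: val_inj; rewrite er.
Qed.

End Paths.

Section PathAlgebra.
Variables (K : nzRingType) (Q : quiver).

(* Finitely supported K-valued functions on the paths of Q. *)
Definition path_algebra := malg (qpath Q) K.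

HB.instance Definition _ := GRing.Lmodule.on path_algebra.

Definition pcoeff (x : path_algebra) (p : qpath Q) : K := mcoeff p x.

Definition pmonom (c : K) (p : option (qpath Q)) : path_algebra :=
  if p is Some p' then mkmalgU p' c else 0.

Definition pa_one : path_algebra := \sum_v pmonom 1 (Some (trivial_path v)).

Definition pa_mul (x y : path_algebra) : path_algebra :=
  \sum_(p <- msupp x) \sum_(q <- msupp y)
     pmonom (pcoeff x p * pcoeff y q) (pcomp p q).


Lemma pmonom0 p : pmonom 0 p = 0.
Proof. by case: p => //= p; exact: monalgU0. Qed.

Lemma pmonomD c d p : pmonom (c + d) p = pmonom c p + pmonom d p.
Proof. by case: p => /= [p|]; [exact: monalgUD | rewrite addr0]. Qed.

Lemma pmonomZ a c p : a *: pmonom c p = pmonom (a * c) p.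
Proof.
case: p => [p|]; last exact: scaler0.
rewrite /pmonom; move: (@mkmalgU _ _ p) (@mcoeffU _ K p) => U UE.
by apply/malgP => q; rewrite mcoeffZ !UE mulrnAr.
Qed.

Lemma pmonomE (x : path_algebra) :
  x = \sum_(p <- msupp x) pmonom (pcoeff x p) (Some p).
Proof. exact: monalgE. Qed.

Lemma pa_mulw (d1 d2 : {fset qpath Q}) x y :
  (msupp x `<=` d1 -> msupp y `<=` d2 ->
  pa_mul x y = \sum_(p <- d1) \sum_(q <- d2)
     pmonom (pcoeff x p * pcoeff y q) (pcomp p q))%fset.
Proof.
move=> l1 l2; rewrite /pa_mul (big_fset_incl _ l1) /=; last first.
  move=> p _ /mcoeff_outdom xp; rewrite big1 // => q _.
  by rewrite /pcoeff xp mul0r pmonom0.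
apply: eq_bigr => p _; apply: big_fset_incl => // q _ /mcoeff_outdom yq.
by rewrite /pcoeff yq mulr0 pmonom0.
Qed.

Lemma pa_mulDl : left_distributive pa_mul +%R.
Proof.
move=> x y z.
rewrite (pa_mulw (msuppD_le x y) (fsubset_refl _)).
rewrite (pa_mulw (fsubsetUl (msupp x) (msupp y)) (fsubset_refl (msupp z))).
rewrite (pa_mulw (fsubsetUr (msupp x) (msupp y)) (fsubset_refl (msupp z))).
rewrite -big_split /=; apply: eq_bigr => p _.
rewrite -big_split /=; apply: eq_bigr => q _.
by rewrite -pmonomD -mulrDl /pcoeff mcoeffD.
Qed.

Lemma pa_mulDr : right_distributive pa_mul +%R.
Proof.
move=> z x y.
rewrite (pa_mulw (fsubset_refl _) (msuppD_le x y)).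
rewrite (pa_mulw (fsubset_refl (msupp z)) (fsubsetUl (msupp x) (msupp y))).
rewrite (pa_mulw (fsubset_refl (msupp z)) (fsubsetUr (msupp x) (msupp y))).
rewrite -big_split /=; apply: eq_bigr => p _.
rewrite -big_split /=; apply: eq_bigr => q _.
by rewrite -pmonomD -mulrDr /pcoeff mcoeffD.
Qed.

Lemma pa_mul0l : left_zero 0 pa_mul.
Proof. by move=> x; apply: (addrI (pa_mul 0 x)); rewrite -pa_mulDl !addr0. Qed.

Lemma pa_mul0r : right_zero 0 pa_mul.
Proof. by move=> x; apply: (addrI (pa_mul x 0)); rewrite -pa_mulDr !addr0. Qed.

Lemma pa_mul_suml I (r : seq I) (F : I -> path_algebra) y :
  pa_mul (\sum_(i <- r) F i) y = \sum_(i <- r) pa_mul (F i) y.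
Proof. exact: (big_morph (pa_mul^~ y) (fun a b => pa_mulDl a b y) (pa_mul0l y)). Qed.

Lemma pa_mul_sumr I (r : seq I) (F : I -> path_algebra) x :
  pa_mul x (\sum_(i <- r) F i) = \sum_(i <- r) pa_mul x (F i).
Proof. exact: (big_morph (pa_mul x) (pa_mulDr x) (pa_mul0r x)). Qed.

Lemma pa_mulUU c d (p q : qpath Q) :
  pa_mul (pmonom c (Some p)) (pmonom d (Some q)) = pmonom (c * d) (pcomp p q).
Proof.
rewrite (@pa_mulw [fset p]%fset [fset q]%fset) ?msuppU_le //.
by rewrite !big_seq_fset1 /pcoeff !mcoeffUU.
Qed.

Lemma pa_mulOO c d (p q : option (qpath Q)) :
  pa_mul (pmonom c p) (pmonom d q) =
  pmonom (c * d) (obind (fun p' => obind (pcomp p') q) p).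
Proof.
case: p => [p|] /=; last exact: pa_mul0l.
by case: q => [q|] /=; [exact: pa_mulUU | exact: pa_mul0r].
Qed.

(* Unification is very slow if it can unfold pmonom, hence the generalization
   over it here and below. *)
Lemma pa_mulA : associative pa_mul.
Proof.
move=> x y z; rewrite [x]pmonomE [y]pmonomE [z]pmonomE.
move: pmonom pa_mulOO => U UO.
rewrite !pa_mul_suml; apply: eq_bigr => p _.
rewrite pa_mul_sumr [X in _ = pa_mul X _]pa_mul_sumr pa_mul_suml.
apply: eq_bigr => q _; rewrite !pa_mul_sumr; apply: eq_bigr => r _.
by rewrite !UO mulrA /= pcompA.
Qed.

Lemma pa_mul1l : left_id pa_one pa_mul.
Proof.
move=> x; rewrite [in RHS](pmonomE x) [in LHS](pmonomE x) /pa_one.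
have UN c : pmonom c None = 0 by [].
move: pmonom UN pa_mulOO => U UN UO.
rewrite pa_mul_sumr; apply: eq_bigr => p _.
rewrite pa_mul_suml (bigD1 (psrc p)) //= big1 => [|v nv].
  by rewrite UO mul1r /= pcomp1 eqxx addr0.
by rewrite UO /= pcomp1 (negbTE nv) UN.
Qed.

Lemma pa_mul1r : right_id pa_one pa_mul.
Proof.
move=> x; rewrite [in RHS](pmonomE x) [in LHS](pmonomE x) /pa_one.
have UN c : pmonom c None = 0 by [].
move: pmonom UN pa_mulOO => U UN UO.
rewrite pa_mul_suml; apply: eq_bigr => p _.
rewrite pa_mul_sumr (bigD1 (ptgt p)) //= big1 => [|v nv].
  by rewrite UO mulr1 /= pcomp1r eqxx addr0.
by rewrite UO /= pcomp1r (negbTE nv) UN.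
Qed.

(* Not an nzRing: the path algebra of the empty quiver is zero. *)
HB.instance Definition _ := GRing.Zmodule_isPzRing.Build path_algebra
  pa_mulA pa_mul1l pa_mul1r pa_mulDl pa_mulDr.

Lemma pa_mulE (x y : path_algebra) : x * y = pa_mul x y.
Proof. by []. Qed.

Lemma pa_scaleAl (a : K) (x y : path_algebra) : a *: (x * y) = (a *: x) * y.
Proof.
rewrite !pa_mulE [x]pmonomE [y]pmonomE.
move: pmonom pmonomZ pa_mulOO => U UZ UO.
rewrite pa_mul_suml !scaler_sumr pa_mul_suml.
apply: eq_bigr => p _; rewrite UZ !pa_mul_sumr scaler_sumr.
by apply: eq_bigr => q _; rewrite !UO UZ mulrA.
Qed.

Local Open Scope classical_set_scope.

(* J^m, for J the ideal generated by the arrows: it is spanned by the paths of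
   length at least m. *)
Definition arrow_ideal_pow (m : nat) : set path_algebra :=
  [set x | forall p, p \in msupp x -> (m <= plen p)%N].

Definition two_sided_ideal (I : set path_algebra) : Prop :=
  [/\ I 0, forall x y, I x -> I y -> I (x + y) &
      forall a x b, I x -> I (a * x * b)].

Definition admissible (I : set path_algebra) : Prop :=
  two_sided_ideal I /\
  exists m : nat, [/\ (2 <= m)%N, arrow_ideal_pow m `<=` I
                    & I `<=` arrow_ideal_pow 2].

End PathAlgebra.

Lemma pa_scaleAr (K : comNzRingType) (Q : quiver) (a : K)
    (x y : path_algebra K Q) : a *: (x * y) = x * (a *: y).
Proof.
rewrite !pa_mulE [x]pmonomE [y]pmonomE.
move: (@pmonom K Q) (@pmonomZ K Q) (@pa_mulOO K Q) => U UZ UO.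
rewrite !pa_mul_suml !scaler_sumr.
apply: eq_bigr => p _; rewrite !pa_mul_sumr scaler_sumr.
by apply: eq_bigr => q _; rewrite UZ !UO UZ mulrCA.
Qed.

Local Open Scope classical_set_scope.

(* A is isomorphic to KQ/I, given as a surjective morphism of K-algebras KQ -> A
   with kernel I. *)
Definition quiver_algebra (K : fieldType) (Q : quiver) (A : falgType K) : Prop :=
  exists (I : set (path_algebra K Q)) (phi : {linear path_algebra K Q -> A}),
    [/\ admissible I, monoid_morphism phi, (forall y, exists x, phi x = y)
      & forall x, phi x = 0 <-> I x].

(** * Nakayama algebras *)

Lemma line_target_subproof n (i : 'I_n.-1) : (i.+1 < n)%N.
Proof. by rewrite -ltn_predRL. Qed.

Definition line_quiver (n : nat) : quiver :=
  @Quiver 'I_n 'I_n.-1 (widen_ord (leq_pred n))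
    (fun i => Ordinal (line_target_subproof i)).

Definition cycle_quiver (n : nat) : quiver := @Quiver 'I_n 'I_n id (@ordS n).

(* Both quivers are connected, and admissible quotients of their path algebras
   are non-semisimple, except for the line with one vertex (A = K). Reversing all
   arrows preserves this class of algebras, so the order in which paths are
   composed is immaterial. *)
Definition nakayama (K : fieldType) (n : nat) (A : falgType K) : Prop :=
  ((1 < n)%N /\ quiver_algebra (line_quiver n) A) \/
  ((0 < n)%N /\ quiver_algebra (cycle_quiver n) A).

(** * Modules over a ring *)

Section Modules.
Variable S : nzRingType.
Implicit Types M N P E : lmodType S.

Definition fin_gen M : Prop :=
  exists (k : nat) (g : 'I_k -> M),
    forall x, exists c : 'I_k -> S, x = \sum_i c i *: g i.

Definition isomorphic M N : Prop := exists f : {linear M -> N}, bijective f.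

Definition submodule M (U : set M) : Prop :=
  U 0 /\ forall a x y, U x -> U y -> U (a *: x + y).

Definition indecomposable M : Prop :=
  (exists x : M, x != 0) /\
  forall U V : set M, submodule U -> submodule V ->
    (forall x, exists2 u, U u & exists2 v, V v & x = u + v) ->
    U `&` V = [set 0] -> U = [set 0] \/ V = [set 0].

(* Projectivity and injectivity within the finitely generated modules. *)
Definition projective P : Prop :=
  forall M N (f : {linear M -> N}) (g : {linear P -> N}),
    fin_gen M -> fin_gen N -> (forall y, exists x, f x = y) ->
    exists h : {linear P -> M}, forall x, f (h x) = g x.

Definition injective_module E : Prop :=
  forall M N (f : {linear M -> N}) (g : {linear M -> E}),
    fin_gen M -> fin_gen N -> injective f ->
    exists h : {linear N -> E}, forall x, h (f x) = g x.

Definition essential M (U : set M) : Prop :=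
  forall V : set M, submodule V -> U `&` V = [set 0] -> V = [set 0].

(* 0 -> M -> I_0 -> I_1 -> ..., each I_i being an injective hull of the image of
   the map into it. *)
Record min_inj_coresolution M := MinInjCoresolution {
  cores_obj : nat -> lmodType S;
  cores_aug : {linear M -> cores_obj 0%N};
  cores_diff : forall i, {linear cores_obj i -> cores_obj i.+1};
  cores_fin_gen : forall i, fin_gen (cores_obj i);
  cores_injective : forall i, injective_module (cores_obj i);
  cores_aug_inj : injective cores_aug;
  cores_exact0 : forall x, cores_diff 0%N x = 0 <-> range cores_aug x;
  cores_exactS : forall i x,
    cores_diff i.+1 x = 0 <-> range (cores_diff i) x;
  cores_essential0 : essential (range cores_aug);
  cores_essentialS : forall i, essential (range (cores_diff i)) }.

Local Open Scope ereal_scope.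

(* R only serves to form the extended reals in which dimensions are counted. *)
Variable R : realType.

Definition cores_domdim M (c : min_inj_coresolution M) : \bar R :=
  if `[< projective (cores_obj c 0%N) >] then
    ereal_sup [set k%:R%:E | k in
      [set k : nat | forall i, (i <= k)%N -> projective (cores_obj c i)]] + 1
  else 0.

(* A finitely generated module over a finite-dimensional algebra has a minimal
   injective coresolution, unique up to isomorphism, so this is the supremum of a
   single value. *)
Definition domdim M : \bar R := ereal_sup [set d | exists c, d = @cores_domdim M c].

(* Finite families of pairwise non-isomorphic modules with property P. *)
Definition iso_distinct (P : lmodType S -> Prop) m (X : 'I_m -> lmodType S) :=
  (forall i, P (X i)) /\ (forall i j, isomorphic (X i) (X j) -> i = j).

(* Number of isomorphism classes with property P. *)
Definition iso_classes_card (P : lmodType S -> Prop) : \bar R :=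
  ereal_sup [set d | exists m (X : 'I_m -> lmodType S),
                       iso_distinct P X /\ d = m%:R%:E].

(* Sum of F >= 0 over the isomorphism classes with property P, as the supremum of
   the finite partial sums. *)
Definition iso_classes_sum (P : lmodType S -> Prop)
    (F : lmodType S -> \bar R) : \bar R :=
  ereal_sup [set d | exists m (X : 'I_m -> lmodType S),
                       iso_distinct P X /\ d = \sum_i F (X i)].

End Modules.

(** * Invariants of an algebra *)

Section Algebras.
Variables (R : realType) (K : fieldType) (A : falgType K).

(* Right A-modules are left modules over the converse ring A^c; this is A_A. *)
Definition right_regular : lmodType A^c := (A^c)^o%type.

Definition selfinjective : Prop := injective_module right_regular.

Definition algebra_domdim : \bar R := domdim R right_regular.

Definition defect : \bar R :=
  iso_classes_card R (fun M : lmodType A^c =>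
    [/\ fin_gen M, indecomposable M, injective_module M & ~ projective M]).

Definition sdomdim : \bar R :=
  iso_classes_sum (fun M : lmodType A^c =>
    [/\ fin_gen M, indecomposable M, projective M & ~ injective_module M])
    (@domdim A^c R).

End Algebras.

(* Main.v *)
Require Import Defs.
From HB Require Import structures.
From mathcomp Require Import all_boot all_order all_algebra all_field.
From mathcomp Require Import finmap.
From mathcomp Require Import boolp classical_sets reals constructive_ereal ereal.
From mathcomp Require Import -(notations) monalg.
From mathcomp Require Import zify.

(** Indecomposable modules are uniserial, and are drawn as intervals of vertices
    modulo n; let g x be the top of the longest interval with bottom x.  The
    injective hull of an interval is the longest interval with the same bottom.
    Hence, if P is an indecomposable projective with bottom x_0 and top x_1, and
    x_(k+2) = g x_k, then the k-th term of the minimal injective coresolution of P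
    is the longest interval with bottom x_k, which is projective if and only if x_k
    is the bottom of a projective.

    Modulo n, the map g is injective on the n - d bottoms of projectives, where d is
    the defect, and its image is the set of the tops of the injective projectives.
    So the sequences x_1, x_3, ... of the d non-injective projectives, as long as
    they consist of bottoms of projectives, are injective and pairwise disjoint, and
    the dominant dimensions add up to at most 2 (n - d) + d = 2 n - d.  This suffices
    unless d = 1.  If d = 1 and x_1, x_3, ... runs through all n - 1 bottoms of
    projectives, then one of these is x_0, and x_0, x_2, ... leaves the set of these
    bottoms within 2 n - 2 steps. *)

Set Implicit Arguments.
Unset Strict Implicit.
Unset Printing Implicit Defensive.

Import Order.TTheory GRing.Theory Num.Theory.

(** * Combinatorics of Kupisch series *)

(** An interval with bottom x and length L consists of the vertices x + 1, ..., x + L, so the top of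
    one interval is the bottom of the next. The cokernel of the interval from x_0 to x_1 in its
    hull, which reaches up to g x_0, is the interval from x_1 to g x_0; this is the origin of the
    recursion. The terms of a coresolution are known only through their axioms. Instead of a
    Krull-Schmidt theorem, explicit bases are carried along: chains under [t] are prolonged inside
    I_k by divisibility, essentiality shows that they then span I_k, and their upper ends form a
    basis of the next cosyzygy. Upper bounds suffice: if I_0, ..., I_k are projective, then x_k is
    the bottom of a projective, and the defect is at most the number of non-injective projectives.
    The one lower bound, that the defect is at least 1, allows dividing by it. It is read off from
    the coresolution itself, which contains the longest interval over the first x_k that is not the
    bottom of a projective. If there is no coresolution, the dominant dimension is the supremum of
    the empty set. *)

(** Here [R] stands for the bottoms of projectives modulo n, [G] for g, [B] for the tops of the
    non-injective projectives and [b] for the bottom of such a projective. The bounds [k.*2.+1] and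
    [k.*2] come from the odd and the even terms of the sequence. *)
Lemma orbit_sum_bound (T : finType) (R : {set T}) (G b : T -> T) (D : T -> nat) :
  {in R &, injective G} -> [set G x | x : T] \subset G @: R ->
  let B := ~: [set G x | x : T] in
  (forall p, p \in B -> b p \in R) ->
  (forall p k, p \in B -> iter k G p \notin R -> D p <= k.*2.+1) ->
  (forall p k, p \in B -> iter k G (b p) \notin R -> D p <= k.*2) ->
  B != finset.set0 -> \sum_(p in B) D p <= 2 * #|T| - 2.
Proof.
move=> injG subG B bR D1 D2 B0.
have BE p x : p \in B -> p <> G x.
  by rewrite inE => /negP pB e; apply: pB; rewrite e imset_f.
have cardB : #|R| + #|B| = #|T|.
  rewrite -(cardsC [set G x | x : T]); congr (_ + _).
  rewrite -(card_in_imset injG); apply: eq_card => x; apply/idP/idP.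
    by case/imsetP => y _ ->; rewrite imset_f.
  by apply/fintype.subsetP.
clearbody B.
(* Cancelling [G] from both sides ends at an element of [B], which is not a value of [G]; hence both
   orbits end at the same time. *)
have iterI k j p q : p \in B -> q \in B ->
    (forall i, i < k -> iter i G p \in R) -> (forall i, i < j -> iter i G q \in R) ->
    iter k G p = iter j G q -> k = j /\ p = q.
  move=> pB qB; elim: k j => [|k IH] [|j] //= hk hj e.
  - by case: (BE _ _ pB e).
  - by case: (BE _ _ qB (esym e)).
  have [|||-> ->] // := IH j.
  - by move=> i ik; apply: hk; rewrite ltnS ltnW.
  - by move=> i ik; apply: hj; rewrite ltnS ltnW.
  - by apply: injG e; [apply: hk | apply: hj].
(* Pigeonhole: an orbit that stays in [R] for [#|R|.+1] steps would be injective there. The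
   implication makes the exit time [o] total. *)
have exN p : exists k, (p \in B) ==> (iter k G p \notin R).
  case: (boolP (p \in B)) => pB; last by exists 0.
  case: (boolP [exists k : 'I_(#|R|.+1), iter k G p \notin R]) => [/existsP[k ?]|].
    by exists k.
  rewrite negb_exists => /forallP H.
  have H' k : k <= #|R| -> iter k G p \in R.
    by move=> kR; have := H (Ordinal (kR : k < #|R|.+1)); rewrite negbK.
  have inj : injective (fun k : 'I_(#|R|.+1) => iter k G p).
    move=> k j e; apply: val_inj => /=.
    have [i ik|i ij|-> _ //] := iterI _ _ _ _ pB pB _ _ e; apply: H'.
      by apply/ltnW/(leq_trans ik); rewrite -ltnS.
    by apply/ltnW/(leq_trans ij); rewrite -ltnS.
  have: #|[set iter k G p | k : 'I_(#|R|.+1)]| <= #|R|.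
    apply/subset_leq_card/fintype.subsetP => x /imsetP[k _ ->]; apply: H'.
    by rewrite -ltnS.
  by rewrite card_imset // card_ord ltnn.
pose o p := ex_minn (exN p).
have oN p : p \in B -> iter (o p) G p \notin R.
  by move=> pB; rewrite /o; case: ex_minnP => k; rewrite pB.
have oR p k : p \in B -> k < o p -> iter k G p \in R.
  rewrite /o; case: ex_minnP => j _ jm pB; rewrite ltnNge; apply: contraR => h.
  by apply: jm; rewrite pB.
pose O p := [set iter k G p | k : 'I_(o p)].
have OR p : p \in B -> O p \subset R.
  by move=> pB; apply/fintype.subsetP => x /imsetP[k _ ->]; apply: oR.
have cardO p : p \in B -> #|O p| = o p.
  move=> pB; rewrite card_imset ?card_ord // => k j e; apply: val_inj => /=.
  have [i ik|i ij|-> _ //] := iterI _ _ _ _ pB pB _ _ e; apply: oR => //.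
    exact: ltn_trans ik _.
  exact: ltn_trans ij _.
have sumo : \sum_(p in B) o p <= #|R|.
  rewrite (eq_bigr (fun p => \sum_(y in R) (y \in O p))); last first.
    move=> p pB; rewrite -big_mkcondr /= sum1_card -(cardO p pB).
    apply: eq_card => x.
    rewrite [RHS]unfold_in /= andbC.
    by case: (boolP (x \in O p)) => // /(fintype.subsetP (OR p pB)) ->.
  rewrite exchange_big /= -sum1_card; apply: leq_sum => y _.
  case: (boolP [exists p in B, y \in O p]) => [/existsP[p /andP[pB yp]]|]; last first.
    rewrite negb_exists => /forallP h; rewrite big1 // => p pB.
    by have := h p; rewrite pB /=; case: (y \in O p).
  rewrite (bigD1 p) //= big1 ?addn0 ?leq_b1 // => q /andP[qB qp].
  case: (boolP (y \in O q)) => // yq; case/imsetP: yp => k _ e.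
  case/imsetP: yq => j _; rewrite e => ekj.
  have [i ik|i ij|_ e'] := iterI _ _ _ _ pB qB _ _ ekj.
  - by apply: oR => //; apply: ltn_trans ik _.
  - by apply: oR => //; apply: ltn_trans ij _.
  by rewrite e' eqxx in qp.
have Do p : p \in B -> D p <= (o p).*2.+1 by move=> pB; apply: D1 => //; apply: oN.
have [p pB] := finset.set0Pn _ B0.
suff: \sum_(p in B) D p <= 2 * (#|R| + #|B|) - 2 by rewrite cardB.
have B1 : 0 < #|B| by rewrite card_gt0.
(* The exit times give 2 |R| + |B| = 2 |T| - |B|, which falls short of the claim by one when |B| =
   1. *)
have [B2|B2] := leqP 2 #|B|.
  have : \sum_(p in B) D p <= \sum_(p in B) (o p + o p + 1).
    by apply: leq_sum => q qB; have := Do q qB; lia.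
  rewrite !big_split /= sum1_card.
  lia.
have /eqP/cards1P [q Bq] : #|B| = 1 by lia.
have qp : q = p by move: pB; rewrite Bq inE => /eqP.
have sumB F : \sum_(p in B) F p = F p by rewrite Bq big_set1 qp.
move: sumo; rewrite !sumB => sumo.
have := Do p pB; have [|le] := ltnP (o p) #|R|; first by lia.
have OE : O p = R.
  by apply/eqP; rewrite eqEcard OR //= cardO.
have := bR p pB; rewrite -{1}OE => /imsetP[k _ e].
(* As [b p] is the k-th point of the orbit of [p], its own orbit leaves [R] after [o p - k]
   steps. *)
have Dk : D p <= (o p - k).*2.
  apply: D2 => //; rewrite e -iterD subnK ?oN //.
  by apply/ltnW/ltn_ord.
have Dp : D p <= (o p).*2 by apply: leq_trans Dk _; rewrite leq_double leq_subr.
by lia.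
Qed.

Lemma periodic_modn (X : Type) (n : nat) (f : nat -> X) :
  (forall i, f (i + n) = f i) -> forall i j, i = j %[mod n] -> f i = f j.
Proof.
move=> fn i j ij.
have fk k q : f (q + k * n) = f q.
  by elim: k => [|k IH]; rewrite ?addn0 // mulSnr addnA fn.
by rewrite (divn_eq i n) (divn_eq j n) ij addnC fk addnC fk.
Qed.

(** * Longest intervals over a given bottom, for a Kupisch series [c] *)

Section Kupisch.
Variables (c : nat -> nat) (n m : nat).
Hypotheses (n_gt0 : 0 < n) (c_per : forall i, c (i + n) = c i).
Hypotheses (c_gt0 : forall i, 0 < c i) (cS : forall i, c i.+1 <= (c i).+1).
Hypothesis c_le : forall i, c i <= m.

(** The interval with top x + L and length L is a module exactly if L is at most the length
    [c (x + L)] of the projective with that top. The bound [m] on [c] makes the maximum finite. *)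
Definition hull_len x := \max_(L < m.+1 | L <= c (x + L)) L.
Definition hull_top x := x + hull_len x.
Definition proj_bot x := c (hull_top x) == hull_len x.

Lemma hull_len_max x L : L <= c (x + L) -> L <= hull_len x.
Proof.
move=> h; have Lm : L < m.+1 by rewrite ltnS (leq_trans h).
by rewrite (@leq_bigmax_cond _ (fun L : 'I_m.+1 => L <= c (x + L)) (fun L =>
  L : nat) (Ordinal Lm)).
Qed.

Lemma hull_len_le x : hull_len x <= c (hull_top x).
Proof.
rewrite /hull_top /hull_len.
have [|L h ->] // := @eq_bigmax_cond _ (fun L : 'I_m.+1 => L <= c (x + L)) (fun L =>
  L : nat).
by apply/card_gt0P; exists ord0; rewrite unfold_in.
Qed.

Lemma hull_len_gt0 x : 0 < hull_len x.
Proof. exact: hull_len_max. Qed.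

Lemma cD i k : c (i + k) <= c i + k.
Proof.
elim: k => [|k IH]; first by rewrite !addn0.
by rewrite !addnS (leq_trans (cS _)).
Qed.

Lemma hull_top_mono x y : x <= y -> hull_top x <= hull_top y.
Proof.
move=> xy; rewrite leqNgt; apply/negP => lt.
have yx : y + (hull_top x - y) = hull_top x.
  by rewrite subnKC // ltnW // (leq_ltn_trans _ lt) // leq_addr.
have : hull_top x - y <= hull_len y.
  apply: hull_len_max; rewrite yx (leq_trans _ (hull_len_le x)) // /hull_top.
  lia.
by rewrite /hull_top in lt *; lia.
Qed.

(** Since [c] grows by at most one per step, above the top of a projective with bottom x the length
    available at the top of the hull is no more than the hull itself. *)
Lemma proj_botI x L : c (x + L) = L -> proj_bot x.
Proof.
move=> h; have := hull_len_max (eq_leq (esym h)) => le.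
rewrite /proj_bot eqn_leq hull_len_le andbT /hull_top.
by rewrite -{1}(subnKC le) addnA (leq_trans (cD _ _)) // h subnKC.
Qed.

Lemma proj_bot_inj x y : proj_bot x -> proj_bot y -> hull_top x = hull_top y -> x = y.
Proof.
move=> /eqP hx /eqP hy e; apply/eqP; rewrite -(eqn_add2r (hull_len x)).
by rewrite -{2}hx e hy -/(hull_top x) -/(hull_top y) e.
Qed.

Lemma proj_bot_lt x y : proj_bot x -> proj_bot y -> x < y -> hull_top x < hull_top y.
Proof.
move=> hx hy xy; rewrite ltn_neqAle (hull_top_mono (ltnW xy)) andbT.
by apply/eqP => /(proj_bot_inj hx hy) e; rewrite e ltnn in xy.
Qed.

Lemma hull_len_mod x y : x = y %[mod n] -> hull_len x = hull_len y.
Proof.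
apply: periodic_modn => i; rewrite /hull_len; apply: eq_bigl => L.
by rewrite addnAC c_per.
Qed.

Lemma c_mod x y : x = y %[mod n] -> c x = c y.
Proof. exact: periodic_modn. Qed.

Lemma hull_top_mod x y : x = y %[mod n] -> hull_top x = hull_top y %[mod n].
Proof.
by move=> e; rewrite /hull_top (hull_len_mod e) -modnDml e modnDml.
Qed.

Lemma proj_bot_mod x y : x = y %[mod n] -> proj_bot x = proj_bot y.
Proof. by move=> e; rewrite /proj_bot (hull_len_mod e) (c_mod (hull_top_mod e)). Qed.

Definition cores_seq u v k := iter k./2 hull_top (if odd k then v else u).

Lemma cores_seqSS u v k : cores_seq u v k.+2 = hull_top (cores_seq u v k).
Proof. by rewrite /cores_seq /= negbK. Qed.

(** Strict growth means that the k-th cosyzygy is nonzero. In general g is only weakly increasing;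
    on bottoms of projectives it is strictly so. *)
Lemma cores_seq_lt u v k : u < v -> v < hull_top u ->
  (forall i, i < k -> proj_bot (cores_seq u v i)) ->
  cores_seq u v k < cores_seq u v k.+1.
Proof.
move=> uv vu.
have [j] := ubnP k; elim: j k => // j IH [|[|k]] //= kj h.
rewrite !cores_seqSS; apply: proj_bot_lt; [exact: h | exact: h |].
by apply: IH => [|i ik]; [lia | apply: h; lia].
Qed.

(* The shift keeps the bottom of the projective nonnegative. *)
Definition ptop (p : 'I_n) := p + m * n.
Definition pbot (p : 'I_n) := ptop p - c p.
Definition noninj_tops : {set 'I_n} := [set p | hull_len (pbot p) != c p].

Lemma c_ptop (p : 'I_n) : c (ptop p) = c p.
Proof. by apply: c_mod; rewrite /ptop addnC modnMDl. Qed.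

Lemma pbotK (p : 'I_n) : pbot p + c p = ptop p.
Proof.
rewrite /pbot subnK // /ptop (leq_trans (c_le p)) // (leq_trans (leq_pmulr m n_gt0)) //.
exact: leq_addl.
Qed.

Lemma hull_len_pbot (p : 'I_n) : c p <= hull_len (pbot p).
Proof. by apply: hull_len_max; rewrite pbotK c_ptop. Qed.

Lemma proj_bot_pbot (p : 'I_n) : proj_bot (pbot p).
Proof. by apply: (@proj_botI _ (c p)); rewrite pbotK c_ptop. Qed.

Definition modI (x : nat) : 'I_n := Ordinal (ltn_pmod x n_gt0).

Lemma modI_mod x : modI x = x %[mod n].
Proof. by rewrite /= modn_mod. Qed.

Lemma modI_eq x y : modI x = modI y -> x = y %[mod n].
Proof. by move=> e; rewrite -modI_mod e modI_mod. Qed.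

(** If p is the top of a longest interval with bottom x, the projective with top p has a bottom y <=
    x. As g is monotone, the longest interval over y also ends at p, so it is that projective. *)
Lemma noninj_topsE :
  noninj_tops = ~: [set modI (hull_top i) | i : 'I_n].
Proof.
apply/finset.setP => p; rewrite !inE; congr (~~ _); apply/eqP/imsetP => [h|[i _ e]].
  exists (modI (pbot p)) => //; apply: val_inj => /=.
  rewrite (@hull_top_mod _ (pbot p)) ?modn_mod // /hull_top h pbotK /ptop.
  by rewrite addnC modnMDl modn_small.
have ep : p = hull_top i %[mod n] by rewrite e modI_mod.
have le : hull_len i <= c p by rewrite (c_mod ep) hull_len_le.
pose x := i + m * n; pose y := hull_top x - c p.
have ix : x = i %[mod n] by rewrite /x addnC modnMDl.
have cx : c (hull_top x) = c p by rewrite (c_mod (hull_top_mod ix)) (c_mod ep).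
have xy : y + c p = hull_top x.
  rewrite subnK // -cx (leq_trans (c_le _)) // /hull_top /x.
  by have := leq_pmulr m n_gt0; lia.
have yx : y <= x.
  by rewrite -(leq_add2r (c p)) xy /hull_top leq_add2l (hull_len_mod ix).
have ly : hull_len y = c p.
  apply/eqP; rewrite eqn_leq hull_len_max ?andbT; last by rewrite xy cx.
  by rewrite -(leq_add2l y) -/(hull_top y) xy hull_top_mono.
rewrite -ly; apply: hull_len_mod.
apply/eqP; rewrite -(eqn_modDr (c p)) pbotK xy /ptop.
by rewrite addnC modnMDl ep (hull_top_mod ix).
Qed.

Definition proj_bots : {set 'I_n} := [set i : 'I_n | proj_bot i].
Definition next_bot (i : 'I_n) := modI (hull_top i).

Lemma ptop_mod (p : 'I_n) : ptop p = p %[mod n].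
Proof. by rewrite /ptop addnC modnMDl. Qed.

Lemma next_bot_modI x : next_bot (modI x) = modI (hull_top x).
Proof. by apply: val_inj => /=; apply: hull_top_mod; rewrite modn_mod. Qed.

Lemma iter_next_bot k x : iter k next_bot (modI x) = modI (iter k hull_top x).
Proof. by elim: k => //= k ->; rewrite next_bot_modI. Qed.

Lemma modI_proj_bots x : (modI x \in proj_bots) = proj_bot x.
Proof. by rewrite inE; apply: proj_bot_mod; rewrite modI_mod. Qed.

Lemma next_bot_inj : {in proj_bots &, injective next_bot}.
Proof.
move=> i j; rewrite !inE => hi hj e.
have cij : hull_len i = hull_len j.
  by rewrite -(eqP hi) -(eqP hj); apply/c_mod/modI_eq.
apply: val_inj; rewrite /= -(modn_small (ltn_ord i)) -(modn_small (ltn_ord j)).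
by apply/eqP; rewrite -(eqn_modDr (hull_len i)) {2}cij; apply/eqP/modI_eq.
Qed.

(** A value of g is the top of an injective projective, by [noninj_topsE], hence also the value of g
    at the bottom of that projective. *)
Lemma next_bot_proj_bots : [set next_bot i | i : 'I_n] \subset next_bot @: proj_bots.
Proof.
apply/fintype.subsetP => p pim;
  have : p \notin noninj_tops by rewrite noninj_topsE inE negbK.
rewrite inE negbK => /eqP h.
apply/imsetP; exists (modI (pbot p)); first by rewrite modI_proj_bots proj_bot_pbot.
rewrite next_bot_modI /hull_top h pbotK; apply: val_inj => /=.
by rewrite ptop_mod modn_small.
Qed.

Lemma card_noninj_tops : #|noninj_tops| = #|~: proj_bots|.
Proof.
have e : next_bot @: proj_bots = [set next_bot i | i : 'I_n].
  apply/eqP; rewrite finset.eqEsubset next_bot_proj_bots andbT.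
  by apply/fintype.subsetP => x /imsetP[i _ ->]; apply: imset_f.
by rewrite noninj_topsE cardsCs [RHS]cardsCs !finset.setCK
  -e (card_in_imset next_bot_inj).
Qed.

Lemma noninj_tops_sum_bound (D : 'I_n -> nat) :
  (forall p k, p \in noninj_tops ->
     ~~ proj_bot (cores_seq (pbot p) (ptop p) k) -> D p <= k) ->
  noninj_tops != finset.set0 -> \sum_(p in noninj_tops) D p <= 2 * n - 2.
Proof.
move=> hD B0.
have := @orbit_sum_bound _ proj_bots next_bot (fun p =>
  modI (pbot p)) D next_bot_inj next_bot_proj_bots.
rewrite -noninj_topsE card_ord => /(_ _ _ _ B0); apply.
- by move=> p _; rewrite modI_proj_bots proj_bot_pbot.
- move=> p k pB; have {1}-> : p = modI (ptop p) by apply: val_inj;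
  rewrite /= ptop_mod modn_small.
  rewrite iter_next_bot modI_proj_bots => h; apply: hD => //.
  by rewrite /cores_seq /= odd_double uphalf_double.
- move=> p k pB; rewrite iter_next_bot modI_proj_bots => h; apply: hD => //.
  by rewrite /cores_seq odd_double doubleK.
Qed.

(** If the first 2 n terms were all bottoms of projectives, the sum bound would apply to the
    function with value 2 n at p and 0 elsewhere, giving 2 n <= 2 n - 2. *)
Lemma cores_seq_not_proj p : p \in noninj_tops ->
  exists k, ~~ proj_bot (cores_seq (pbot p) (ptop p) k).
Proof.
move=> pB.
case: (boolP [exists k : 'I_(2 * n), ~~ proj_bot (cores_seq (pbot p) (ptop p) k)]).
  by case/existsP => k; exists k.
rewrite negb_exists => /forallP all_proj.
have := @noninj_tops_sum_bound (fun q => if q == p then 2 * n else 0).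
rewrite (bigD1 p) //= eqxx => bound.
suff: 2 * n <= 2 * n - 2 by lia.
apply: leq_trans (leq_addr _ _) (bound _ _); last by apply/finset.set0Pn; exists p.
move=> q k _; case: eqP => // ->; rewrite [_ <= k]leqNgt; apply: contra => kn.
by have := all_proj (Ordinal kn); rewrite negbK.
Qed.
End Kupisch.

(** * Submodules and linear maps *)

Local Open Scope classical_set_scope.
Local Open Scope ring_scope.

Section Submodules.
Variables (S : nzRingType) (M : lmodType S).

Section SubmoduleType.
Variables (U : set M) (subU : submodule U).

(** The proof is an argument so that unification can recover the submodule structure from the
    predicate. *)
Definition in_submodule (_ : submodule U) : {pred M} := fun x => `[< U x >].

Lemma in_submodule_closed : GRing.submod_closed (in_submodule subU).
Proof.
have [U0 Ulin] := subU; split; first by apply/asboolP.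
by move=> a x y /asboolP Ux /asboolP Uy; apply/asboolP; apply: Ulin.
Qed.

HB.instance Definition _ :=
  GRing.isSubmodClosed.Build S M (in_submodule subU) in_submodule_closed.

Definition submodule_type := {x : M | x \in in_submodule subU}.

HB.instance Definition _ := SubChoice.on submodule_type.
HB.instance Definition _ := [SubChoice_isSubLmodule of submodule_type by <:].

Definition incl : submodule_type -> M := val.
HB.instance Definition _ := GRing.Linear.on incl.

Lemma incl_inj : injective incl. Proof. exact: val_inj. Qed.

Lemma inclP x : U (incl x). Proof. by apply/asboolP; apply: (valP x). Qed.

Lemma incl_surj x : U x -> exists y, incl y = x.
Proof. by move=> /asboolP Ux; exists (Sub x Ux); apply: SubK. Qed.

End SubmoduleType.
End Submodules.

(** Two values at one point differ by a value at 0, so the relation is a function. Maps on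
    generators are defined in this way without choosing representatives. *)
Lemma linear_of_graph (S : nzRingType) (M N : lmodType S) (G : M -> N -> Prop) :
  (forall x, exists y, G x y) ->
  (forall a x y x' y', G x y -> G x' y' -> G (a *: x + x') (a *: y + y')) ->
  (forall y, G 0 y -> y = 0) ->
  exists f : {linear M -> N}, forall x, G x (f x).
Proof.
move=> tot lin fct; have [f fG] := choice tot.
have G_fct x y : G x y -> y = f x.
  move=> Gxy; apply/eqP; rewrite -subr_eq0; apply/eqP/fct.
  by have := lin (-1) _ _ _ _ (fG x) Gxy; rewrite !scaleN1r addNr addrC.
have fl : linear f by move=> a x y; apply/esym/G_fct/lin.
pose h := GRing.isLinear.Build S M N *:%R f fl.
pose F : {linear M -> N} := HB.pack f h.
by exists F.
Qed.

(** * Modules over a Nakayama ring *)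

(* The opposite of a Nakayama algebra with n simple modules. The vertices are
   indexed modulo n and against the arrows, so that the sum t of all arrows
   lowers the index by one; a line is a cycle with one arrow equal to zero. *)
Record nakayama_ring (K : fieldType) (S : nzRingType) (n : nat) := NakayamaRing {
  nr_iota : {rmorphism K -> S};
  nr_m : nat;
  nr_e : nat -> S;
  nr_t : S;
  n_gt0 : (0 < n)%N;
  iotaC : forall a s, nr_iota a * s = s * nr_iota a;
  eM : forall i j, nr_e i * nr_e j = if i == j %[mod n] then nr_e i else 0;
  e_per : forall i, nr_e (i + n)%N = nr_e i;
  e_neq0 : forall i, nr_e i != 0;
  e_sum : \sum_(i < n) nr_e i = 1;
  te : forall i, nr_t * nr_e i.+1 = nr_e i * nr_t;
  tm : nr_t ^+ nr_m = 0;
  spanS : forall s, exists lam : 'I_n -> nat -> K,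
    s = \sum_(i < n) \sum_(k < nr_m) nr_iota (lam i k) * (nr_t ^+ k * nr_e i) }.

Section NakayamaRing.
Variables (K : fieldType) (S : nzRingType) (n : nat) (X : nakayama_ring K S n).
Local Notation iota := (nr_iota X).
Local Notation e := (nr_e X).
Local Notation t := (nr_t X).
Local Notation m := (nr_m X).
Let n_gt0 : (0 < n)%N := n_gt0 X.

Lemma e_mod i j : i = j %[mod n] -> e i = e j.
Proof. exact: (periodic_modn (e_per X)). Qed.

Lemma tXe i k : t ^+ k * e (i + k)%N = e i * t ^+ k.
Proof.
elim: k => [|k IH]; first by rewrite addn0 expr0 mulr1 mul1r.
by rewrite exprSr addnS -mulrA (te X) mulrA IH mulrA.
Qed.

Lemma tXe_ex i : exists k, t ^+ k * e i == 0.
Proof. by exists m; rewrite (tm X) mul0r. Qed.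

(** The length of the indecomposable projective [S e_i], that is, the Kupisch series. *)
Definition plength i := ex_minn (tXe_ex i).

Lemma tXe_plength i : t ^+ plength i * e i = 0.
Proof. by rewrite /plength; case: ex_minnP => k /eqP. Qed.

Lemma plength_le i k : t ^+ k * e i = 0 -> (plength i <= k)%N.
Proof. by rewrite /plength; case: ex_minnP => j _ h /eqP/h. Qed.

Lemma plengthP i k : t ^+ k * e i != 0 -> (k < plength i)%N.
Proof.
apply: contraR; rewrite -leqNgt => /subnK <-.
by rewrite exprD -mulrA tXe_plength mulr0.
Qed.

Lemma tXe_neq0 i k : (k < plength i)%N -> t ^+ k * e i != 0.
Proof. by rewrite ltnNge; apply: contra => /eqP/plength_le. Qed.

Lemma plength_gt0 i : (0 < plength i)%N.
Proof. by apply: plengthP; rewrite expr0 mul1r (e_neq0 X). Qed.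

Lemma plengthS i : (plength i.+1 <= (plength i).+1)%N.
Proof. by apply: plength_le; rewrite exprSr -mulrA (te X) mulrA tXe_plength mul0r. Qed.

Lemma plength_le_m i : (plength i <= m)%N.
Proof. by apply: plength_le; rewrite (tm X) mul0r. Qed.

Lemma plength_per i : plength (i + n) = plength i.
Proof.
by apply/eqP; rewrite eqn_leq !plength_le //
  ?(e_per X) ?tXe_plength // -(e_per X) tXe_plength.
Qed.

Lemma mul_e_coef s i : exists lam : nat -> K,
  s * e i = \sum_(k < m) iota (lam k) * (t ^+ k * e i).
Proof.
have [lam ->] := spanS X s; pose i0 := modI n_gt0 i.
have ei : e i = e i0 by apply: e_mod; rewrite modI_mod.
exists (lam i0); rewrite ei mulr_suml (bigD1 i0) //= [X in _ + X]big1 => [|j ji].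
  rewrite addr0 mulr_suml; apply: eq_bigr => k _.
  by rewrite -!mulrA eM eqxx.
rewrite mulr_suml big1 // => k _; rewrite -!mulrA eM.
by rewrite (modn_small (ltn_ord j)) (modn_small (ltn_ord i0))
  (inj_eq val_inj) (negbTE ji) !mulr0.
Qed.

Lemma e_eq0 i j : i != j %[mod n] -> e i * e j = 0.
Proof. by rewrite eM => /negbTE ->. Qed.

Lemma e_idem i : e i * e i = e i.
Proof. by rewrite eM eqxx. Qed.

Section Modules.
Implicit Types M N E : lmodType S.

Lemma iota_scaleC M a s (x : M) : iota a *: (s *: x) = s *: (iota a *: x).
Proof. by rewrite !scalerA iotaC. Qed.

Lemma iota_scale_eq0 M a (x : M) : iota a *: x = 0 -> a = 0 \/ x = 0.
Proof.
have [->|a0] := eqVneq a 0; [by left | move=> ax; right].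
by rewrite -(scale1r x) -(rmorph1 iota) -(mulVf a0) rmorphM -scalerA ax scaler0.
Qed.

Lemma scale_e_eq0 M i j (x : M) : i != j %[mod n] -> e j *: x = x -> e i *: x = 0.
Proof. by move=> ij <-; rewrite scalerA e_eq0 // scale0r. Qed.

Lemma scale_e_mod M i j (x : M) : i = j %[mod n] -> e j *: x = x -> e i *: x = x.
Proof. by move=> /e_mod ->. Qed.

Lemma scale_tXe M i k (x : M) : e (i + k)%N *: x = x ->
  e i *: (t ^+ k *: x) = t ^+ k *: x.
Proof. by move=> ex; rewrite scalerA -tXe -scalerA ex. Qed.

Lemma vertex_mod M i j (x : M) : x != 0 -> e i *: x = x -> e j *: x = x -> i = j %[mod n].
Proof.
move=> x0 ei ej; apply/eqP; apply: contraNT x0 => ij.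
by rewrite -ei (scale_e_eq0 ij ej).
Qed.

Lemma tX_plength M i k (x : M) : e i *: x = x -> t ^+ k *: x != 0 -> (k < plength i)%N.
Proof.
move=> ex; rewrite -ex scalerA => tx; apply: plengthP; apply: contraNN tx => /eqP ->.
by rewrite scale0r.
Qed.

Lemma tX_eq0 M i k (x : M) : e i *: x = x -> (plength i <= k)%N -> t ^+ k *: x = 0.
Proof.
move=> ex h; apply/eqP; apply: contraTT h; rewrite -ltnNge; exact: tX_plength.
Qed.

(** The coefficients depend on [s] and [i] alone, not on the module, so a relation found in one
    module can be transferred to another. *)
Lemma scale_coef s i : exists lam : nat -> K, forall M (x : M), e i *: x = x ->
  s *: x = \sum_(k < m) iota (lam k) *: (t ^+ k *: x).
Proof.
have [lam E] := mul_e_coef s i; exists lam => M x ex.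
rewrite -ex scalerA E scaler_suml; apply: eq_bigr => k _.
by rewrite !scalerA !mulrA.
Qed.

Lemma sum_e M (x : M) : x = \sum_(i < n) e i *: x.
Proof. by rewrite -scaler_suml (e_sum X) scale1r. Qed.

(** For the least j with a nonzero coefficient, [t ^+ (L - j)] kills all terms but the j-th. *)
Lemma power_free M (y : M) L d (lam : nat -> K) :
  t ^+ L *: y != 0 -> t ^+ L.+1 *: y = 0 ->
  \sum_(j < d) iota (lam j) *: (t ^+ j *: y) = 0 ->
  forall j, (j < d)%N -> (j <= L)%N -> lam j = 0.
Proof.
move=> yL yL1 s0; elim/ltn_ind => j IH jN jL.
have := congr1 (fun x => t ^+ (L - j) *: x) s0.
rewrite scaler0 scaler_sumr (bigD1 (Ordinal jN)) //= big1 => [|i ij].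
  rewrite addr0 -iota_scaleC (scalerA (t ^+ _)) -exprD subnK // =>
    /iota_scale_eq0[] // y0.
  by rewrite y0 eqxx in yL.
have [ltij|] := ltnP i j.
  by rewrite IH // ?(leq_trans (ltnW ltij)) // rmorph0 scale0r scaler0.
rewrite leq_eqVlt => /orP[/eqP ij'|ji].
  by case/eqP: ij; apply: val_inj.
rewrite -iota_scaleC (scalerA (t ^+ _)) -exprD.
have /subnK <- : (L.+1 <= L - j + i)%N by lia.
by rewrite exprD -scalerA yL1 !scaler0.
Qed.

(** * Injectivity as divisibility by powers of [t] *)

(** Baer's condition for the left ideals generated by [t ^+ k * e (i + k)]: the generator can be
    sent to [v] exactly if the displayed power of [t] kills [v], and [w] is the image of [e (i + k)]
    under an extension to S. *)
Definition divisible M : Prop := forall i k (v : M), e i *: v = v ->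
  t ^+ (plength (i + k) - k) *: v = 0 ->
    exists2 w, e (i + k)%N *: w = w & t ^+ k *: w = v.

Lemma annihilator_tXe M s i k (v : M) : e i *: v = v ->
  t ^+ (plength (i + k) - k) *: v = 0 -> s * (t ^+ k * e (i + k)%N) = 0 -> s *: v = 0.
Proof.
move=> ev tv s0; have [lam E] := scale_coef s i; rewrite (E M v ev).
(* Here the truncated exponent is 0, and the hypothesis says that [v] is zero. *)
have [le|lt] := leqP (plength (i + k)) k.
  move: tv; rewrite (eqP (le : (_ - _ == 0)%N)) expr0 scale1r => ->.
  by rewrite big1 // => j _; rewrite !scaler0.
pose y : S^o := t ^+ k * e (i + k)%N.
have ey : e i *: y = y by rewrite /y tXe /GRing.scale /= mulrA e_idem.
have yS j : t ^+ j *: y = t ^+ (j + k) * e (i + k)%N :> S by rewrite exprD -mulrA.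
set L := (plength (i + k) - k.+1)%N.
have lam0 : forall j, (j < m)%N -> (j <= L)%N -> lam j = 0.
  apply: (@power_free _ y).
  - by rewrite yS tXe_neq0 // /L; lia.
  - by rewrite yS /L (_ : _ + k = plength (i + k))%N ?tXe_plength //; lia.
  - by rewrite -(E _ y ey).
rewrite big1 // => j _; have [jL|jL] := leqP j L.
  by rewrite lam0 // rmorph0 scale0r.
have /subnK <- : (plength (i + k) - k <= j)%N by rewrite /L in jL; lia.
by rewrite exprD -scalerA tv !scaler0.
Qed.

Lemma injective_divisible E : injective_module E -> divisible E.
Proof.
move=> injE i k v ev tv; pose s0 : S^o := t ^+ k * e (i + k)%N.
pose U : set S^o := fun s => exists s', s = s' * s0.
have subU : submodule U.
  split; first by exists 0; rewrite mul0r.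
  by move=> a _ _ [x ->] [y ->]; exists (a * x + y); rewrite mulrDl -mulrA.
pose M := submodule_type subU.
have [g0 g0E] : exists g0 : M, incl g0 = s0 by apply: incl_surj; exists 1; rewrite mul1r.
have fgM : fin_gen M.
  exists 1%N, (fun=> g0) => x; have [s sE] := inclP x.
  by exists (fun=> s); rewrite big_ord1; apply: incl_inj; rewrite linearZ /= g0E sE.
have fgS : fin_gen S^o.
  by exists 1%N, (fun=> 1) => x; exists (fun=> x); rewrite big_ord1 /GRing.scale /= mulr1.
have [g gE] : exists g : {linear M -> E}, forall x,
    exists2 s, incl x = s * s0 & g x = s *: v.
  apply: (@linear_of_graph S M E (fun x y => exists2 s, incl x = s * s0 & y = s *: v)).
  - by move=> x; have [s sE] := inclP x; exists (s *: v), s.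
  - move=> a x y x' y' [s xs ->] [s' xs' ->]; exists (a * s + s').
      by rewrite linearP /= xs xs' mulrDl -mulrA.
    by rewrite scalerDl scalerA.
  - move=> y [s]; rewrite linear0 => /esym s0E ->.
    exact: annihilator_tXe tv s0E.
have [h hE] := injE M S^o (@incl _ _ _ subU) g fgM fgS (@incl_inj _ _ _ subU).
exists (e (i + k)%N *: h 1); first by rewrite scalerA e_idem.
have [s sE gs] := gE g0.
rewrite scalerA -linearZ /=.
have -> : (t ^+ k * e (i + k)%N) *: (1 : S^o) = s0 by rewrite /GRing.scale /= mulr1.
rewrite -g0E hE gs; apply/eqP; rewrite -subr_eq0 -{2}(scale1r v) -scalerBl; apply/eqP.
by apply: annihilator_tXe ev tv _; rewrite mulrBl mul1r -sE g0E subrr.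
Qed.

Definition partial_linear N E (G : N -> E -> Prop) : Prop :=
  [/\ G 0 0, forall a x y x' y', G x y -> G x' y' -> G (a *: x + x') (a *: y + y')
    & forall y, G 0 y -> y = 0].

(* Baer's argument: the annihilator of c modulo the domain of G is generated by
   a power of t, so that c can be sent to any suitable root of the image of the
   corresponding multiple of c. *)
Lemma extend_partial_linear N E (G : N -> E -> Prop) i (c : N) :
  divisible E -> partial_linear G -> e i *: c = c ->
  exists G' : N -> E -> Prop, [/\ partial_linear G', forall x y, G x y -> G' x y
    & exists w, G' c w].
Proof.
move=> divE [G0 Glin Gfun] ec.
have GZ a x y : G x y -> G (a *: x) (a *: y).
  by move=> Gxy; have := Glin a _ _ _ _ Gxy G0; rewrite !addr0.
have GD x y x' y' : G x y -> G x' y' -> G (x + x') (y + y').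
  by move=> h h'; have := Glin 1 _ _ _ _ h h'; rewrite !scale1r.
have exr : exists r, `[< exists v, G (t ^+ r *: c) v >].
  by exists m; apply/asboolP; exists 0; rewrite (tm X) scale0r.
case: (ex_minnP exr) => r /asboolP[v1 Gv1] rmin.
have rP k : (k < r)%N -> ~ exists v, G (t ^+ k *: c) v.
  by move=> kr /asboolP/rmin; rewrite leqNgt kr.
(* This is i - r modulo n, written without subtraction. *)
pose i' := (i + n.-1 * r)%N.
have i'r : (i' + r)%N = i %[mod n].
  rewrite /i' -addnA -mulSnr prednK //.
  by rewrite addnC mulnC modnMDl.
have eri : e (i' + r)%N = e i by apply: e_mod.
have ci : plength (i' + r) = plength i := c_mod plength_per i'r.
pose v0 := e i' *: v1.
have Gv0 : G (t ^+ r *: c) v0.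
  by have := GZ (e i') _ _ Gv1; rewrite scale_tXe // eri.
have rp : (r <= plength i)%N.
  by apply/rmin/asboolP; exists 0; rewrite (tX_eq0 ec).
have [w ew tw] : exists2 w, e (i' + r)%N *: w = w & t ^+ r *: w = v0.
  apply: divE; first by rewrite /v0 scalerA e_idem.
  apply: Gfun; have := GZ (t ^+ (plength i - r)) _ _ Gv0.
  by rewrite scalerA -exprD subnK // (tX_eq0 ec) // ci.
rewrite eri in ew.
exists (fun x y => exists u v s, [/\ G u v, x = u + s *: c & y = v + s *: w]); split.
- split.
  + by exists 0, 0, 0; rewrite !scale0r !addr0.
  + move=> a _ _ _ _ [u [v [s [Guv -> ->]]]] [u' [v' [s' [Guv' -> ->]]]].
    exists (a *: u + u'), (a *: v + v'), (a * s + s'); split; first exact: Glin.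
      by rewrite scalerDl scalerDr -scalerA addrACA.
    by rewrite scalerDl scalerDr -scalerA addrACA.
  + move=> _ [u [v [s [Guv usc ->]]]].
    have [lam E0] := scale_coef s i.
    have sc : s *: c = - u by apply/eqP; rewrite -addr_eq0 addrC -usc.
    (* A first nonzero coefficient below r would, after multiplication by [t ^+ (r.-1 - k)], put
       [t ^+ r.-1 *: c] into the domain, against the minimality of r. Hence [s *: c] is a multiple
       of [t ^+ r *: c], where the two prescriptions agree. *)
    have lam0 k : (k < m)%N -> (k < r)%N -> lam k = 0.
      elim/ltn_ind: k => k IH km kr; apply/eqP/negP => /negP lk.
      apply: (rP r.-1); first by rewrite prednK // (leq_ltn_trans _ kr).
      have : exists v, G (t ^+ (r.-1 - k) *: (s *: c)) v.
        by exists (- (t ^+ (r.-1 - k) *: v)); rewrite sc -scaleN1r -!scalerN;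
           rewrite -!scaleN1r; apply/GZ/GZ.
      rewrite (E0 _ _ ec) scaler_sumr (bigD1 (Ordinal km)) //=.
      rewrite -iota_scaleC (scalerA (t ^+ _)) -exprD (_ : (r.-1 - k + k)%N = r.-1);
        last by lia.
      set rest := \sum_(j < m | _) _.
      have [v' Gr] : exists v', G rest v'.
        rewrite /rest; elim/big_ind: _ => [|x y [x' ?] [y' ?]|j jk].
        - by exists 0.
        - by exists (x' + y'); apply: GD.
        have [jk'|] := ltnP j k.
          by exists 0; rewrite IH // ?(ltn_trans jk') // rmorph0 scale0r scaler0.
        rewrite leq_eqVlt => /orP[/eqP kj|kj].
          by case/eqP: jk; apply: val_inj.
        have jr : (r <= r.-1 - k + j)%N by lia.
        exists (iota (lam j) *: (t ^+ (r.-1 - k + j - r) *: v0)).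
        rewrite -iota_scaleC (scalerA (t ^+ _)) -exprD -{1}(subnK jr) exprD -scalerA.
        by apply/GZ/GZ.
      move=> [v'' Gs]; exists (iota (lam k)^-1 *: (v'' - v')).
      have := GZ (iota (lam k)^-1) _ _ (Glin (-1) _ _ _ _ Gr Gs).
      rewrite !scaleN1r (addrC (- rest)) addrK (scalerA (iota _) (iota _))
        -rmorphM mulVf // rmorph1 scale1r.
      by rewrite (addrC (- v')).
    pose s' := \sum_(k < m) iota (lam k) * t ^+ (k - r).
    have s'E (P : lmodType S) (x : P) : e i *: x = x -> s' *: (t ^+ r *: x) = s *: x.
      move=> ex; rewrite (E0 _ _ ex) scaler_suml; apply: eq_bigr => k _.
      have [kr|kr] := ltnP k r; first by rewrite lam0 // rmorph0 mul0r !scale0r.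
      by rewrite -scalerA (scalerA (t ^+ _)) -exprD subnK.
    apply: Gfun; rewrite usc -(s'E _ _ ec) -(s'E _ _ ew) tw.
    by apply: GD => //; apply: GZ.
- by move=> x y Gxy; exists x, y, 0; rewrite !scale0r !addr0.
- by exists w, 0, 0, 1; rewrite !scale1r !add0r.
Qed.

(** The target is generated by finitely many elements lying in single components, so finitely many
    one-element extensions suffice and no maximality principle enters. *)
Lemma divisible_injective E : divisible E -> injective_module E.
Proof.
move=> divE M N f g fgM [k [gen genN]] injf.
have extend (s : seq N) : (forall c, c \in s -> exists i, e i *: c = c) ->
    exists G : N -> E -> Prop, [/\ partial_linear G, forall x, G (f x) (g x)
      & forall c, c \in s -> exists w, G c w].
  elim: s => [|c s IH] hs.
    exists (fun x y => exists2 z, x = f z & y = g z); split=> //; last by move=> x;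
      exists x.
    split; first by exists 0; rewrite linear0.
    - move=> a _ _ _ _ [z -> ->] [z' -> ->]; exists (a *: z + z'); by rewrite linearP.
    - by move=> _ [z fz ->]; rewrite (_ : z = 0) ?linear0 //; apply: injf;
      rewrite -fz linear0.
  have [|G [linG Gfg Gs]] := IH; first by move=> x xs; apply: hs; rewrite inE xs orbT.
  have [i ec] : exists i, e i *: c = c by apply: hs; rewrite inE eqxx.
  have [G' [linG' GG' [w Gw]]] := extend_partial_linear divE linG ec.
  exists G'; split=> // [x|x]; first exact/GG'/Gfg.
  by rewrite inE => /predU1P[->|/Gs[v /GG']]; [exists w | exists v].
have [|G [[G0 Glin Gfun] Gfg Gs]] :=
  extend [seq e i *: gen j | i <- seq.iota 0 n, j <- enum 'I_k].
  by move=> _ /allpairsP[[i j] [_ _ ->]]; exists i; rewrite /= scalerA e_idem.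
have G_sum (I : finType) (F : I -> N) :
    (forall j, exists y, G (F j) y) -> exists y, G (\sum_j F j) y.
  move=> hF; elim/big_ind: _ => [|x y [x' ?] [y' ?]|j _]; [by exists 0 | | exact: hF].
  by exists (x' + y'); have := Glin 1 x x' y y'; rewrite !scale1r; apply.
have GZ a x : (exists y, G x y) -> exists y, G (a *: x) y.
  by move=> [y Gxy]; exists (a *: y); have := Glin a x y 0 0; rewrite !addr0; apply.
have [x|h hG] := linear_of_graph _ Glin Gfun.
  have [a ->] := genN x; apply: (G_sum) => j; apply: GZ; rewrite (sum_e (gen j)).
  apply: (G_sum) => i; apply: Gs; apply/allpairsP; exists (nat_of_ord i, j).
  by rewrite mem_iota mem_enum /=.
exists h => x; apply/eqP; rewrite -subr_eq0; apply/eqP/Gfun.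
have := Glin (-1) _ _ _ _ (Gfg x) (hG (f x)); rewrite !scaleN1r addNr.
by rewrite addrC.
Qed.

(** * Direct sums of uniserial modules in coordinates *)

Section Chains.
Variables (M : lmodType S) (T : finType).
Implicit Types (x l : T -> nat) (Y : T -> nat -> M) (lam mu : T -> nat -> K).

Definition chain x l Y : Prop :=
  [/\ forall a, Y a 0%N = 0,
      forall a h, (h < l a)%N -> t *: Y a h.+1 = Y a h &
      forall a h, (h < l a)%N -> e (x a + h.+1)%N *: Y a h.+1 = Y a h.+1].

Definition comb l Y lam := \sum_a \sum_(h < l a) iota (lam a h) *: Y a h.+1.

Definition chain_free l Y : Prop :=
  forall lam, comb l Y lam = 0 -> forall a h, (h < l a)%N -> lam a h = 0.

(* U is the direct sum over a : T of uniserial submodules of length l a, where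
   Y a h is in the (x a + h)-th component and generates the submodule of length
   h of the summand at a. *)
Definition chain_basis (U : set M) x l Y : Prop :=
  [/\ chain x l Y, chain_free l Y & forall u, U u <-> exists lam, u = comb l Y lam].

Lemma chain_tX x l Y a h r : chain x l Y -> (h <= l a)%N ->
  t ^+ r *: Y a h = Y a (h - r)%N.
Proof.
move=> [Y0 tY _]; elim: r h => [|r IH] [|h] hl; rewrite ?expr0 ?scale1r //.
  by rewrite Y0 scaler0.
by rewrite exprSr -scalerA tY // (IH _ (ltnW hl)).
Qed.

Lemma comb_tX x l Y lam r : chain x l Y ->
  t ^+ r *: comb l Y lam = \sum_a \sum_(h < l a) iota (lam a h) *: Y a (h.+1 - r)%N.
Proof.
move=> cY; rewrite scaler_sumr; apply: eq_bigr => a _; rewrite scaler_sumr.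
by apply: eq_bigr => h _; rewrite -iota_scaleC (chain_tX _ cY).
Qed.

Lemma eq_comb l Y lam mu : (forall a h, (h < l a)%N -> lam a h = mu a h) ->
  comb l Y lam = comb l Y mu.
Proof. by move=> h; apply: eq_bigr => a _; apply: eq_bigr => i _; rewrite h. Qed.

Lemma combD l Y lam mu :
  comb l Y lam + comb l Y mu = comb l Y (fun a h => lam a h + mu a h).
Proof.
rewrite -big_split; apply: eq_bigr => a _; rewrite -big_split.
by apply: eq_bigr => h _; rewrite /= rmorphD scalerDl.
Qed.

Lemma combZ l Y c lam : iota c *: comb l Y lam = comb l Y (fun a h => c * lam a h).
Proof.
rewrite scaler_sumr; apply: eq_bigr => a _; rewrite scaler_sumr.
by apply: eq_bigr => h _; rewrite rmorphM scalerA.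
Qed.

Lemma comb0 l Y : comb l Y (fun _ _ => 0) = 0.
Proof. by rewrite /comb big1 // => a _; rewrite big1 // => h _;
  rewrite rmorph0 scale0r. Qed.

Lemma comb_delta l Y a h : (h < l a)%N ->
  comb l Y (fun b j => if (b == a) && (j == h) then 1 else 0) = Y a h.+1.
Proof.
move=> hl; rewrite /comb (bigD1 a) //= [X in _ + X]big1 => [|b /negbTE ba].
  rewrite addr0 (bigD1 (Ordinal hl)) //= !eqxx rmorph1 scale1r big1 ?addr0 // => j jh.
  by rewrite (inj_eq val_inj j (Ordinal hl)) (negbTE jh) rmorph0 scale0r.
by rewrite big1 // => j _; rewrite ba rmorph0 scale0r.
Qed.

Lemma comb_socle l Y (mu : T -> K) :
  comb l Y (fun a h => if h == 0%N then mu a else 0) =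
  \sum_(a | (0 < l a)%N) iota (mu a) *: Y a 1%N.
Proof.
rewrite [RHS]big_mkcond; apply: eq_bigr => a _; case: (l a) => [|k];
  first by rewrite big_ord0.
rewrite big_ord_recl /= big1 ?addr0 // => i _.
by rewrite rmorph0 scale0r.
Qed.

(** If r is the largest level with a nonzero coefficient, [t ^+ r] moves that level to the socle and
    kills all lower ones. *)
Lemma chain_free_socle x l Y : chain x l Y ->
  (forall mu : T -> K, \sum_(a | (0 < l a)%N) iota (mu a) *: Y a 1%N = 0 ->
     forall a, (0 < l a)%N -> mu a = 0) ->
  chain_free l Y.
Proof.
move=> cY soc lam lam0.
suff H r : (forall a h, (r <= h)%N -> (h < l a)%N -> lam a h = 0) ->
    forall a h, (h < l a)%N -> lam a h = 0.
  apply: (H (\max_a l a)%N) => a h mh hl.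
  by have := leq_trans hl (leq_trans (leq_bigmax a) mh); rewrite ltnn.
elim: r => [|r IH] hr; first by move=> a h; apply: hr.
apply: IH => a h; rewrite leq_eqVlt => /predU1P[<-|]; last exact: hr.
move=> ra {h}; have := congr1 (fun z => t ^+ r *: z) lam0.
rewrite scaler0 (comb_tX _ _ cY) => s0.
pose mu a := if (r < l a)%N then lam a r else 0.
suff : mu a = 0 by rewrite /mu ra.
apply: soc; last exact: leq_ltn_trans ra.
rewrite -[RHS]s0 big_mkcond; apply: eq_bigr => b _.
have [Y0 _ _] := cY; rewrite /mu; have [rb|rb] := ltnP r (l b).
  rewrite (leq_ltn_trans _ rb) // (bigD1 (Ordinal rb)) //= subSnn big1 ?addr0 // => j jr.
  have [jr'|] := ltnP j r; first by rewrite (eqP (jr' : (j.+1 - r == 0)%N)) Y0 scaler0.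
  rewrite leq_eqVlt => /predU1P[rj|rj]; last by rewrite hr ?rmorph0 ?scale0r.
  by case/eqP: jr; apply: val_inj.
rewrite rmorph0 scale0r if_same big1 // => j _.
have jr : (j < r)%N by apply: leq_trans rb.
by rewrite (eqP (jr : (j.+1 - r == 0)%N)) Y0 scaler0.
Qed.

Lemma chain_free_socleP l Y (mu : T -> K) : chain_free l Y ->
  \sum_(a | (0 < l a)%N) iota (mu a) *: Y a 1%N = 0 -> forall a, (0 < l a)%N -> mu a = 0.
Proof. by move=> free; rewrite -comb_socle => /free h a la; have := h a 0%N la. Qed.

Lemma chain_free_neq0 l Y a h : chain_free l Y -> (h < l a)%N -> Y a h.+1 != 0.
Proof.
move=> free hl; apply/eqP => Y0.
have := free _ (etrans (comb_delta _ hl) Y0) a h hl.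
by rewrite !eqxx => /eqP; rewrite oner_eq0.
Qed.

Lemma comb_e x l Y lam i : chain x l Y ->
  e i *: comb l Y lam =
  comb l Y (fun a h => if x a + h.+1 == i %[mod n] then lam a h else 0).
Proof.
move=> [_ _ eY]; rewrite scaler_sumr; apply: eq_bigr => a _; rewrite scaler_sumr.
apply: eq_bigr => h _; rewrite -iota_scaleC; case: eqVneq => ih.
  by rewrite (scale_e_mod _ (eY a h _)).
by rewrite (scale_e_eq0 _ (eY a h _)) // ?scaler0 ?rmorph0 ?scale0r // eq_sym.
Qed.

Lemma chain_submodule x l Y : chain x l Y ->
  submodule (fun u => exists lam, u = comb l Y lam).
Proof.
move=> cY; pose U (u : M) := exists lam, u = comb l Y lam.
have UD u v : U u -> U v -> U (u + v).
  by move=> [lam ->] [mu ->]; exists (fun a h => lam a h + mu a h); rewrite combD.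
have UZ c u : U u -> U (iota c *: u).
  by move=> [lam ->]; exists (fun a h => c * lam a h); rewrite combZ.
have U0 : U 0 by exists (fun _ _ => 0); rewrite comb0.
have UY a h : (h <= l a)%N -> U (Y a h).
  case: h => [_|h hl]; first by case: cY => ->.
  by eexists; rewrite -(comb_delta Y hl).
have Usum (I : finType) (F : I -> M) : (forall i, U (F i)) -> U (\sum_i F i).
  by move=> hF; elim/big_ind: _.
split=> // s u v [lam ->] Uv; apply: UD => //.
rewrite scaler_sumr; apply: (Usum) => a; rewrite scaler_sumr; apply: (Usum) => h.
rewrite -iota_scaleC; apply: (UZ); have [_ _ eY] := cY.
have [nu ->] := scale_coef s (x a + h.+1)%N; last exact: eY.
by apply: (Usum) => k; apply: (UZ); rewrite (chain_tX _ cY) //;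
  apply/UY/(leq_trans (leq_subr _ _)).
Qed.

Lemma chain_comb x l Y a h : chain x l Y -> (h <= l a)%N ->
  exists lam, Y a h = comb l Y lam.
Proof.
move=> [Y0 _ _]; case: h => [_|h hl]; last by eexists; rewrite -(comb_delta Y hl).
by exists (fun _ _ => 0); rewrite comb0 Y0.
Qed.

Lemma chain_len_le x l Y a : chain x l Y -> chain_free l Y -> (0 < l a)%N ->
  (l a <= plength (x a + l a))%N.
Proof.
move=> cY free la; have [_ _ eY] := cY.
rewrite -{1}(prednK la); apply: (@tX_plength _ _ _ (Y a (l a))).
  by have := eY a (l a).-1; rewrite prednK // => ->.
rewrite (chain_tX _ cY) // (_ : l a - (l a).-1 = 1)%N; last by lia.
exact: (chain_free_neq0 free la).
Qed.

Lemma comb_shift x l Y lam r : chain x l Y ->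
  t ^+ r *: comb l Y lam =
  comb l Y (fun a h => if (h + r < l a)%N then lam a (h + r)%N else 0).
Proof.
move=> cY; rewrite (comb_tX _ _ cY); apply: eq_bigr => a _; have [Y0 _ _] := cY.
have [lr|/ltnW rl] := leqP (l a) r.
  rewrite !big1 // => h _.
    by rewrite ltnNge (leq_trans lr (leq_addl _ _)) rmorph0 scale0r.
  by rewrite (eqP (leq_trans (ltn_ord h) lr : (h.+1 - r == 0)%N)) Y0 scaler0.
pose F h := iota (lam a h) *: Y a (h.+1 - r)%N.
rewrite (_ : \sum_(h < l a) _ = \sum_(0 <= h < l a) F h); last by rewrite big_mkord.
rewrite (big_cat_nat (n := r)) //= [X in X + _]big_nat_cond big1 ?add0r; last first.
  by move=> h /andP[/andP[_ hr] _]; rewrite /F (eqP (hr : (h.+1 - r == 0)%N)) Y0 scaler0.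
rewrite -{1}(add0n r) big_addn big_mkord.
rewrite (big_ord_widen _ (fun h => F (h + r)%N) (leq_subr r (l a))) big_mkcond.
apply: eq_bigr => h _; rewrite ltn_subRL addnC /F -addSn addnK.
by case: ifP; rewrite ?rmorph0 ?scale0r.
Qed.

End Chains.

Local Notation hull := (hull_len plength m).

Lemma hull_max b L : (L <= plength (b + L))%N -> (L <= hull b)%N.
Proof. exact: hull_len_max plength_le_m _ _. Qed.

Lemma hull_le b : (hull b <= plength (b + hull b))%N.
Proof. exact: hull_len_le. Qed.

Lemma hull_gt0 b : (0 < hull b)%N.
Proof. exact: hull_len_gt0 plength_gt0 plength_le_m b. Qed.

(** Every term of [v] can be raised by k levels within its own chain, because the chains are as long
    as their bottoms permit. *)
Lemma hull_divisible E (T : finType) x l (Y : T -> nat -> E) :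
  chain_basis setT x l Y -> (forall a, l a = hull (x a)) -> divisible E.
Proof.
move=> [cY free sp] lh i k v ev tv; have [Y0 tY eY] := cY.
have [lam0 E0] := (sp v).1 I.
have [lam vE lamx] : exists2 lam, v = comb l Y lam &
    forall a h, lam a h != 0 -> x a + h.+1 = i %[mod n].
  exists (fun a h => if x a + h.+1 == i %[mod n] then lam0 a h else 0).
    by rewrite -(comb_e _ _ cY) -E0 ev.
  by move=> a h; case: ifP => [/eqP|_]; rewrite ?eqxx.
(* At a level of at least r, the equation [t ^+ r *: v = 0] kills the coefficient; at a lower level,
   the interval raised by k is still a module, so it fits below the hull. *)
have lamk a h : (h < l a)%N -> lam a h != 0 -> (h.+1 + k <= l a)%N.
  move=> hl; apply: contraNT; rewrite -ltnNge lh => lt.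
  set r := (plength (i + k) - k)%N in tv.
  have [rh|hr] := leqP r h.
    move: tv; rewrite vE (comb_shift _ _ cY) => /free /(_ a (h - r)%N).
    by rewrite subnK // hl (leq_ltn_trans (leq_subr _ _) hl) => ->.
  apply: contraTT lt => lam_ah; rewrite -leqNgt; apply: hull_max.
  have -> : plength (x a + (h.+1 + k)) = plength (i + k).
    apply: (c_mod plength_per); rewrite addnA -modnDml (lamx a h) //.
    by rewrite modnDml.
  by rewrite /r in hr; lia.
exists (\sum_a \sum_(h < l a) iota (lam a h) *: Y a (h.+1 + k)%N).
  rewrite scaler_sumr; apply: eq_bigr => a _; rewrite scaler_sumr; apply: eq_bigr => h _.
  rewrite -iota_scaleC; have [->|lam_ah] := eqVneq (lam a h) 0.
    by rewrite rmorph0 !scale0r.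
  rewrite addSn (scale_e_mod _ (eY a (h + k)%N _)) -?addSn ?lamk //.
  by rewrite addnA -modnDml -(lamx a h) // modnDml.
rewrite vE scaler_sumr; apply: eq_bigr => a _; rewrite scaler_sumr; apply: eq_bigr => h _.
rewrite -iota_scaleC; have [->|lam_ah] := eqVneq (lam a h) 0.
  by rewrite rmorph0 !scale0r.
by rewrite (chain_tX _ cY) ?lamk // addnK.
Qed.

(** * Essential extensions of a module with a chain basis *)

Section Hull.
Variables (E : lmodType S) (U : set E) (T : finType) (x l : T -> nat) (Y : T -> nat -> E).
Hypotheses (divE : divisible E) (essU : essential U) (basU : chain_basis U x l Y).

(** An empty chain has to stay empty: the hull of the zero module is zero, although [hull (x a)] is
    positive. *)
Definition hull_lens a := if l a == 0%N then 0%N else hull (x a).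

Lemma hull_lens_le a : (l a <= hull_lens a)%N.
Proof.
have [cY free _] := basU; rewrite /hull_lens; case: posnP => [->//|la].
exact/hull_max/(chain_len_le cY free).
Qed.

Lemma hull_chain : exists Z : T -> nat -> E, chain x hull_lens Z /\
  forall a h, (h <= l a)%N -> Z a h = Y a h.
Proof.
have [cY free _] := basU; have [Y0 tY eY] := cY.
have /choice [w wP] a : exists w, (0 < l a)%N ->
    e (x a + hull (x a))%N *: w = w /\ t ^+ (hull (x a) - l a) *: w = Y a (l a).
  have [->|la] := posnP (l a); first by exists 0.
  have lh : (l a <= hull (x a))%N by apply/hull_max/(chain_len_le cY free).
  have xlh : (x a + l a + (hull (x a) - l a) = x a + hull (x a))%N by rewrite -addnA subnKC.
  have [||w ew tw] := @divE (x a + l a)%N (hull (x a) - l a)%N (Y a (l a)).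
  - by have := eY a (l a).-1; rewrite prednK // => ->.
  - rewrite xlh (chain_tX _ cY) // -[RHS](Y0 a); congr (Y a _).
    by have := hull_le (x a); lia.
  by exists w => _; rewrite -{1}xlh.
exists (fun a h => if l a == 0%N then Y a h else t ^+ (hull (x a) - h) *: w a).
have ZY a h : (h <= l a)%N ->
  (if l a == 0%N then Y a h else t ^+ (hull (x a) - h) *: w a) = Y a h.
  move=> hl; case: posnP => // la; have [ew tw] := wP a la.
  have lh : (l a <= hull (x a))%N by apply/hull_max/(chain_len_le cY free).
  have -> : (hull (x a) - h = (l a - h) + (hull (x a) - l a))%N by lia.
  by rewrite exprD -scalerA tw (chain_tX _ cY) // subKn.
split=> //; split.
- by move=> a; rewrite ZY.
- move=> a h; rewrite /hull_lens; case: posnP => // la hh.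
  by rewrite scalerA -exprS; congr (t ^+ _ *: _); lia.
- move=> a h; rewrite /hull_lens; case: posnP => // la hh; have [ew tw] := wP a la.
  by apply: scale_tXe; rewrite -addnA subnKC.
Qed.

(** The line spanned by [s] is a simple submodule, so it lies in [U] as soon as it meets [U]. *)
Lemma essential_socle i s : e i *: s = s -> t *: s = 0 -> U s.
Proof.
move=> es ts; have [->|s0] := eqVneq s 0.
  by have [_ _ sp] := basU; apply/sp; exists (fun _ _ => 0); rewrite comb0.
pose V (u : E) := exists k, u = iota k *: s.
have subV : submodule V.
  split; first by exists 0; rewrite rmorph0 scale0r.
  move=> a _ _ [k ->] [k' ->].
  have [lam E0] := scale_coef a i.
  have m_gt0 : (0 < m)%N := leq_trans (plength_gt0 0) (plength_le_m 0).
  exists (k * lam 0%N + k'); rewrite rmorphD scalerDl rmorphM -scalerA; congr (_ + _).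
  rewrite -iota_scaleC (E0 _ _ es) (bigD1 (Ordinal m_gt0)) //= expr0 scale1r.
  rewrite big1 ?addr0 // => j; rewrite -(inj_eq val_inj) /= -lt0n => j0.
  by rewrite -(prednK j0) exprSr -scalerA ts !scaler0.
apply: contrapT => Us; have VN : V <> [set 0].
  move=> VE; have : V s by exists 1; rewrite rmorph1 scale1r.
  by rewrite VE => /eqP; apply/negP.
apply: VN; apply: (@essU V subV); apply/seteqP; split=> u /=; last first.
  have [_ _ sp] := basU; move=> ->; split; last by case: subV.
  by apply/sp; exists (fun _ _ => 0); rewrite comb0.
move=> [Uu [k uk]]; have [k0|k0] := eqVneq k 0; first by rewrite uk k0 rmorph0 scale0r.
case: Us; have [_ _ sp] := basU; have [lam uE] := (sp u).1 Uu; apply/sp.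
by exists (fun a h => k^-1 * lam a h);
  rewrite -combZ -uE uk scalerA -rmorphM mulVf // rmorph1 scale1r.
Qed.

Lemma socle_comb i s : e i *: s = s -> t *: s = 0 ->
  exists2 mu : T -> K, s = \sum_(a | (0 < l a)%N) iota (mu a) *: Y a 1%N
    & forall a, mu a != 0 -> (x a).+1 = i %[mod n].
Proof.
move=> es ts; have [cY free sp] := basU.
have [lam0 E0] := (sp s).1 (essential_socle es ts).
pose lam a h := if x a + h.+1 == i %[mod n] then lam0 a h else 0.
have sE : s = comb l Y lam by rewrite -(comb_e _ _ cY) -E0 es.
exists (fun a => lam a 0%N).
  rewrite -comb_socle {1}sE; apply: eq_comb => a [//|h] hl.
  move: ts; rewrite -[t]expr1 sE (comb_shift _ _ cY) => /free /(_ a h (ltnW hl)).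
  by rewrite addn1 hl.
by move=> a; rewrite /lam addn1; case: ifP => [/eqP//|_]; rewrite eqxx.
Qed.

(** Freeness is tested on the socle, where the chains are unchanged. They span by induction on the
    power of [t] that kills a vector: the last nonzero multiple of the vector lies in the socle,
    hence in [U], and can be cancelled by elements of the prolonged chains. *)
Lemma hull_basis : exists Z : T -> nat -> E, chain_basis setT x hull_lens Z /\
  forall a h, (h <= l a)%N -> Z a h = Y a h.
Proof.
have [cY free _] := basU; have [Z [cZ ZY]] := hull_chain; exists Z; split=> //.
have hl a : (0 < hull_lens a)%N = (0 < l a)%N.
  by rewrite /hull_lens; case: (posnP (l a)) => // _; rewrite hull_gt0.
have freeZ : chain_free hull_lens Z.
  apply: (chain_free_socle cZ) => mu mu0 a; rewrite hl => la.
  apply: (chain_free_socleP free) la; rewrite -[RHS]mu0.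
  by apply: eq_big => b; rewrite ?hl // => lb; rewrite ZY.
pose span (u : E) := exists lam, u = comb hull_lens Z lam.
have [span0 spanP] : submodule span := chain_submodule cZ.
have spanD u v : span u -> span v -> span (u + v).
  by move=> su sv; rewrite -(scale1r u); apply: (spanP).
have spanH r : forall i v, e i *: v = v -> t ^+ r *: v = 0 -> span v.
  elim: r => [|r IH] i v ev; first by rewrite expr0 scale1r => ->.
  rewrite exprS -scalerA => tsv; pose j := (i + n.-1 * r)%N.
  have ji : (j + r)%N = i %[mod n].
    by rewrite /j -addnA -mulSnr prednK // addnC mulnC modnMDl.
  have es : e j *: (t ^+ r *: v) = t ^+ r *: v.
    by apply: scale_tXe; rewrite (e_mod ji).
  have [s0|s0] := eqVneq (t ^+ r *: v) 0; first exact: (IH i v ev s0).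
  have [mu sE muP] := socle_comb es tsv.
  (* As [t ^+ r *: v] is nonzero, the projective at vertex i has length at least r + 1, so every
     chain involved reaches level r + 1. *)
  have muL a : (0 < l a)%N -> mu a != 0 ->
    (r.+1 <= hull_lens a)%N /\ (x a + r.+1)%N = i %[mod n].
    move=> la mua; have xi : (x a + r.+1)%N = i %[mod n].
      by rewrite -ji addnS -addSn -modnDml (muP a mua) modnDml.
    rewrite /hull_lens eqn0Ngt la; split=> //; apply: hull_max.
    by rewrite (c_mod plength_per xi); apply: tX_plength s0.
  pose v1 := \sum_(a | (0 < l a)%N) iota (mu a) *: Z a r.+1.
  have span1 : span v1.
    rewrite /v1; elim/big_ind: _ => // a la.
    have [->|mua] := eqVneq (mu a) 0; first by rewrite rmorph0 scale0r.
    rewrite -[_ *: _]addr0; apply: (spanP) => //.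
    have [ra _] := muL a la mua; by eexists; rewrite -(comb_delta Z ra).
  have -> : v = (v - v1) + v1 by rewrite subrK.
  apply: (spanD) => //; apply: (IH i).
    rewrite scalerBr ev; congr (_ - _); rewrite scaler_sumr; apply: eq_bigr => a la.
    rewrite -iota_scaleC; have [->|mua] := eqVneq (mu a) 0.
      by rewrite rmorph0 !scale0r.
    have [ra xi] := muL a la mua; have [_ _ eZ] := cZ.
    by rewrite (scale_e_mod _ (eZ a r ra)) // xi.
  rewrite scalerBr sE scaler_sumr; apply/eqP; rewrite subr_eq0; apply/eqP/eq_bigr => a la.
  rewrite -iota_scaleC; have [->|mua] := eqVneq (mu a) 0.
    by rewrite rmorph0 !scale0r.
  have [ra xi] := muL a la mua.
  by rewrite (chain_tX _ cZ) // subSnn ZY.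
split=> // u; split=> // _; rewrite (sum_e u); elim/big_ind: _ => // i _.
by apply: (spanH m i); rewrite ?scalerA ?e_idem // (tm X) mul0r scale0r.
Qed.

End Hull.

(** The map [d] kills exactly the lower [l a] levels of each chain; what remains begins where the
    old chain ended. *)
Lemma cosyzygy_basis E E' (d : {linear E -> E'}) (U : set E) (T : finType)
    (x l L : T -> nat) (Y Z : T -> nat -> E) :
  chain_basis U x l Y -> chain_basis setT x L Z -> (forall a, (l a <= L a)%N) ->
  (forall a h, (h <= l a)%N -> Z a h = Y a h) -> (forall u, d u = 0 <-> U u) ->
  chain_basis (range d) (fun a => x a + l a)%N (fun a => L a - l a)%N
    (fun a h => d (Z a (l a + h)%N)).
Proof.
move=> [cY freeY spY] [cZ freeZ spZ] lL ZY dU; have [Z0 tZ eZ] := cZ.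
have [Y0 _ _] := cY.
have split_comb nu : comb L Z nu = comb l Y nu +
    \sum_a \sum_(h < L a - l a) iota (nu a (l a + h)%N) *: Z a (l a + h).+1.
  rewrite -big_split; apply: eq_bigr => a _ /=.
  rewrite -[in LHS](subnKC (lL a)) big_split_ord; congr (_ + _).
  by apply: eq_bigr => h _ /=; rewrite ZY.
have d_rest lam : comb (fun a => L a - l a)%N (fun a h => d (Z a (l a + h)%N)) lam =
    d (\sum_a \sum_(h < L a - l a) iota (lam a h) *: Z a (l a + h).+1).
  rewrite linear_sum; apply: eq_bigr => a _; rewrite linear_sum; apply: eq_bigr => h _.
  by rewrite linearZ addnS.
split.
- split.
  + by move=> a; apply/dU; rewrite addn0 ZY //; apply/spY; apply: chain_comb cY _.
  + by move=> a h hl; rewrite -linearZ /= addnS tZ // -ltn_subRL.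
  + by move=> a h hl; rewrite -linearZ /= -addnA addnS eZ // -ltn_subRL.
- move=> lam; rewrite d_rest => /dU /spY [mu muE] a h hl.
  pose nu a h := if (h < l a)%N then - mu a h else lam a (h - l a)%N.
  have nuE b j : nu b (l b + j)%N = lam b j by rewrite /nu ltnNge leq_addr addKn.
  rewrite -nuE; apply: freeZ; last by rewrite -ltn_subRL.
  rewrite split_comb.
  rewrite (eq_bigr (fun a => \sum_(h < L a - l a) iota (lam a h) *: Z a (l a + h).+1)).
    rewrite muE combD -[RHS](comb0 l Y); apply: eq_comb => b j jb.
    by rewrite /nu jb addNr.
  by move=> b _; apply: eq_bigr => j _; rewrite nuE.
- move=> u; split=> [[v _ <-]|[lam ->]].
    have [nu ->] := (spZ v).1 I; exists (fun a h => nu a (l a + h)%N).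
    rewrite d_rest split_comb linearD /= (_ : d (comb l Y nu) = 0) ?add0r //.
    by apply/dU/spY; exists nu.
  by rewrite d_rest; eexists.
Qed.

(** * Projective modules and their socles *)

Lemma dual_basis M : fin_gen M -> projective M ->
  exists (k : nat) (g : 'I_k -> M) (phi : 'I_k -> {linear M -> S^o}),
    forall x, x = \sum_i phi i x *: g i.
Proof.
move=> fgM projM; have [k [g genM]] := fgM.
pose F : lmodType S := {ffun 'I_k -> S^o}.
have fgF : fin_gen F.
  exists k, (fun i => [ffun j => if j == i then 1 else 0]) => f; exists f.
  apply/ffunP => j; rewrite sum_ffunE (bigD1 j) //= big1 => [|i ij].
    by rewrite !ffunE eqxx addr0 /GRing.scale /= mulr1.
  by rewrite !ffunE eq_sym (negbTE ij) /GRing.scale /= mulr0.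
have [f fE] : exists f : {linear F -> M}, forall c, f c = \sum_i c i *: g i.
  apply: (@linear_of_graph _ F M (fun c y => y = \sum_i c i *: g i)).
  - by move=> c; eexists.
  - move=> a c _ c' _ -> ->; rewrite scaler_sumr -big_split; apply: eq_bigr => i _.
    by rewrite /= !ffunE scalerDl scalerA.
  - by move=> _ ->; rewrite big1 // => i _; rewrite ffunE scale0r.
have [h hE] : exists h : {linear M -> F}, forall x, f (h x) = x.
  apply: (projM F M f idfun) => // y; have [c ->] := genM y.
  exists (finfun c); rewrite fE; apply: eq_bigr => i _; by rewrite ffunE.
have /choice [phi phiE] i : exists phi : {linear M -> S^o}, forall x, phi x = h x i.
  apply: (@linear_of_graph _ M S^o (fun x y => y = h x i)).
  - by move=> x; eexists.
  - by move=> a x _ x' _ -> ->; rewrite linearP !ffunE.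
  - by move=> _ ->; rewrite linear0 ffunE.
exists k, g, phi => x; rewrite -{1}(hE x) fE; apply: eq_bigr => i _.
by rewrite phiE.
Qed.

(** Some coordinate of a dual basis, followed by the projection to some [S e_q], keeps [t ^+ L *: z]
    nonzero. The image is a socle vector of the uniserial module [S e_q], whose bottom is therefore
    b modulo n. *)
Lemma projective_proj_bot M b L (z : M) : fin_gen M -> projective M ->
  e (b + L.+1)%N *: z = z -> t ^+ L *: z != 0 -> t ^+ L.+1 *: z = 0 ->
  proj_bot plength m b.
Proof.
move=> fgM /(dual_basis fgM) [d [g [phi phiE]]] ez zL zL1.
have [i wL] : exists i, t ^+ L * phi i z != 0.
  apply: contrapT => h; case/eqP: zL; rewrite (phiE (t ^+ L *: z)) big1 // => i _.
  rewrite linearZ /=; apply/eqP; apply: contraT => h'; case: h; exists i.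
  by apply: contraNN h' => /eqP h'; rewrite (_ : _ *: _ = 0 :> S^o) ?scale0r.
have {wL} [q uL] : exists q : 'I_n, t ^+ L * (phi i z * e q) != 0.
  apply: contrapT => h; case/eqP: wL; rewrite -[_ * _]mulr1 -(e_sum X) mulr_sumr.
  rewrite big1 // => q _; rewrite -mulrA; apply/eqP; apply: contraT => h'.
  by case: h; exists q.
have [lam E0] := mul_e_coef (phi i z) q.
pose y : S^o := e q; have ey : e q *: y = y by exact: e_idem.
pose u : S^o := phi i z * e q.
have uE : u = \sum_(k < m) iota (lam k) *: (t ^+ k *: y) by [].
have tu r : t ^+ r *: u = \sum_(k < m) iota (lam k) *: (t ^+ (r + k) *: y).
  rewrite uE scaler_sumr; apply: eq_bigr => k _.
  by rewrite -iota_scaleC (scalerA (t ^+ r)) -exprD.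
have tuL1 : t ^+ L.+1 *: u = 0.
  by rewrite /u /GRing.scale /= mulrA -[_ * phi i z]/(t ^+ L.+1 *: (phi i z : S^o))
    -linearZ /= zL1 linear0 mul0r.
have eu : e (b + L.+1)%N *: u = u.
  by rewrite /u /GRing.scale /= mulrA -[_ * phi i z]/(e (b + L.+1)%N *: (phi i z : S^o))
    -linearZ /= ez.
have tuL : t ^+ L *: u != 0 by [].
(* The least such k is the order of [u] in powers of [t]; since exactly [t ^+ L.+1] kills [u], the
   length of [S e_q] is L + k + 1. *)
have ex_k : exists k, (k < m)%N && (lam k != 0).
  apply: contrapT => h; case/eqP: tuL; rewrite tu big1 // => k _.
  have -> : lam k = 0; last by rewrite rmorph0 scale0r.
  by apply/eqP; apply: contraT => lk; case: h; exists k; rewrite lk ltn_ord.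
case: (ex_minnP ex_k) => k /andP[km lk] kmin.
have lam0 j : (j < m)%N -> (j < k)%N -> lam j = 0.
  move=> jm jk; apply/eqP; apply: contraTT jk => lj; rewrite -leqNgt.
  by apply: kmin; rewrite jm.
have big_y j : (plength q <= j)%N -> t ^+ j *: y = 0 by move=> h; apply: (tX_eq0 ey).
have Lk : (L + k < plength q)%N.
  rewrite ltnNge; apply: contraNN tuL => le; rewrite tu big1 // => j _.
  have [jk|kj] := ltnP j k; first by rewrite lam0 // rmorph0 scale0r.
  by rewrite big_y ?scaler0 // (leq_trans le) // leq_add2l.
have kL : (plength q <= L.+1 + k)%N.
  rewrite leqNgt; apply/negP => lt; case/eqP: lk.
  apply: (@power_free S^o (t ^+ L.+1 *: y) (plength q - L.+2) m lam) => //; last by lia.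
  - rewrite scalerA -exprD; have -> : (plength q - L.+2 + L.+1 = (plength q).-1)%N by lia.
    by apply: tXe_neq0; rewrite prednK // plength_gt0.
  - by rewrite scalerA -exprD big_y //; lia.
  - apply: etrans tuL1; rewrite tu; apply: eq_bigr => j _.
    by rewrite (scalerA (t ^+ _) (t ^+ _)) -exprD addnC.
have pq : plength q = (L + k).+1 by lia.
have tuLE : t ^+ L *: u = iota (lam k) *: (t ^+ (L + k) *: y).
  rewrite tu (bigD1 (Ordinal km)) //= big1 ?addr0 // => j;
    rewrite -(inj_eq val_inj) /= => jk.
  have [jk'|kj] := ltnP j k; first by rewrite lam0 // rmorph0 scale0r.
  by rewrite big_y ?scaler0 // pq -addnS leq_add2l ltn_neqAle eq_sym jk.
pose j := (q + n.-1 * (L + k))%N.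
have jq : (j + (L + k))%N = q %[mod n].
  by rewrite /j -addnA -mulSnr prednK // addnC mulnC modnMDl.
have eL : e b.+1 *: (t ^+ L *: u) = t ^+ L *: u.
  by apply: scale_tXe; rewrite addSnnS.
have eL' : e j *: (t ^+ L *: u) = t ^+ L *: u.
  by rewrite tuLE -iota_scaleC scale_tXe // (e_mod jq).
have bj := vertex_mod tuL eL eL'.
apply: (proj_botI plengthS plength_le_m (L := (L + k).+1)); rewrite -pq;
  apply: (c_mod plength_per).
by rewrite pq -jq -addSnnS -modnDml bj modnDml.
Qed.

(* The length of M is L + 1. *)
Definition uniserial_gen M i L (y : M) : Prop :=
  [/\ e i *: y = y, t ^+ L.+1 *: y = 0, t ^+ L *: y != 0
    & forall u, exists s, u = s *: y].

Definition uniserial M i L : Prop := exists y : M, uniserial_gen i L y.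

Lemma uniserial_mod M i j L : i = j %[mod n] -> uniserial M i L -> uniserial M j L.
Proof. by rewrite /uniserial /uniserial_gen => /e_mod ->. Qed.

Lemma uniserial_fin_gen M i L : uniserial M i L -> fin_gen M.
Proof.
move=> [y [_ _ _ geny]]; exists 1%N, (fun=> y) => u; have [s ->] := geny u.
by exists (fun=> s); rewrite big_ord1.
Qed.

Lemma annihilator_eq M N (y : M) (y' : N) i L s : e i *: y = y -> e i *: y' = y' ->
  t ^+ L *: y != 0 -> t ^+ L.+1 *: y = 0 -> t ^+ L.+1 *: y' = 0 -> s *: y = 0 ->
    s *: y' = 0.
Proof.
move=> ey ey' yL yL1 y'L1; have [lam E0] := scale_coef s i;
  rewrite (E0 _ _ ey) (E0 _ _ ey').
move=> /(power_free yL yL1) lam0; rewrite big1 // => j _.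
have [jL|Lj] := leqP j L; first by rewrite lam0 // rmorph0 scale0r.
by rewrite -(subnK Lj) exprD -scalerA y'L1 !scaler0.
Qed.

Lemma uniserial_lift M N i L (y : M) (y' : N) :
  uniserial_gen i L y ->
  e i *: y' = y' -> t ^+ L.+1 *: y' = 0 ->
  exists f : {linear M -> N}, forall s, f (s *: y) = s *: y'.
Proof.
move=> [ey yL1 yL geny] ey' y'L1.
have ann s s' : s *: y = s' *: y -> s *: y' = s' *: y'.
  move=> /eqP; rewrite -subr_eq0 -scalerBl => /eqP/(annihilator_eq ey ey' yL yL1 y'L1).
  by rewrite scalerBl => /eqP; rewrite subr_eq0 => /eqP.
have [|||f fE] := @linear_of_graph S M N (fun u v => exists2 s, u = s *: y & v = s *: y').
- by move=> u; have [s ->] := geny u; exists (s *: y'), s.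
- move=> a _ _ _ _ [s -> ->] [s' -> ->].
  by exists (a * s + s'); rewrite scalerDl scalerA.
- by move=> _ [s s0E ->]; rewrite (ann s 0) ?scale0r // -s0E.
by exists f => s; have [s' /ann sE ->] := fE (s *: y).
Qed.

Lemma uniserial_iso M N i j L : uniserial M i L -> uniserial N j L -> i = j %[mod n] ->
  isomorphic M N.
Proof.
move=> uM uN ij; have [y' genN] := uniserial_mod (esym ij) uN; have [y genM] := uM.
have [ey' y'L1 y'L geny'] := genN; have [ey yL1 yL geny] := genM.
have [f fE] := uniserial_lift genM ey' y'L1; have [g gE] := uniserial_lift genN ey yL1.
exists f; exists g => u; first by have [s ->] := geny u; rewrite fE gE.
by have [s ->] := geny' u; rewrite gE fE.
Qed.

Lemma uniserial_basis M b L : uniserial M (b + L.+1) L -> exists Y : nat -> M,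
  chain_basis setT (fun _ : unit => b) (fun=> L.+1) (fun=> Y).
Proof.
move=> [y [ey yL1 yL geny]]; exists (fun h => t ^+ (L.+1 - h) *: y).
have cY : chain (fun _ : unit => b) (fun=> L.+1) (fun _ h => t ^+ (L.+1 - h) *: y).
  split=> [a|a h hL|a h hL]; first by rewrite subn0.
    by rewrite scalerA -exprS subSS subSn.
  by apply: scale_tXe; rewrite -addnA subnKC.
split=> //.
  apply: (chain_free_socle cY) => mu; rewrite (bigD1 tt) //= big1 => [|[]//].
  rewrite addr0 subSS subn0 => /iota_scale_eq0[mu0 []//|y0].
  by rewrite y0 eqxx in yL.
move=> u; split=> // _; have [s ->] := geny u.
have [_ spanP] := chain_submodule cY.
have [lam yE] := chain_comb (a := tt) cY (leqnn L.+1).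
have := spanP s _ _ (ex_intro _ lam yE) (ex_intro _ (fun _ _ => 0) (esym (comb0 _ _))).
by rewrite subnn expr0 scale1r addr0.
Qed.

Lemma uniserial_injective M b L : uniserial M (b + L.+1) L -> L.+1 = hull b ->
  injective_module M.
Proof.
move=> /uniserial_basis [Y basY] Lh; apply/divisible_injective.
by apply: (hull_divisible basY).
Qed.

Lemma uniserial_projective M i L : uniserial M i L -> L.+1 = plength i -> projective M.
Proof.
move=> [y genM] Li P N f g _ _ surjf; have [x fx] := surjf (g y).
have [ey yL1 yL geny] := genM.
have [||h hE] := @uniserial_lift M P i L y (e i *: x) genM.
- by rewrite scalerA e_idem.
- by rewrite scalerA Li tXe_plength scale0r.
exists h => u; have [s ->] := geny u.
by rewrite hE !linearZ /= fx -linearZ /= ey.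
Qed.

Lemma uniserial_not_projective M b L : uniserial M (b + L.+1) L ->
  ~~ proj_bot plength m b ->
  ~ projective M.
Proof.
move=> uM /negP nb projM; apply: nb; have [y [ey yL1 yL _]] := uM.
exact: projective_proj_bot (uniserial_fin_gen uM) projM ey yL yL1.
Qed.

(** The term of lowest order in a nonzero element can be moved to the socle by a power of [t], which
    kills the rest. *)
Lemma uniserial_socle M i L (y : M) (U : set M) :
  uniserial_gen i L y ->
  submodule U -> U = [set 0] \/ U (t ^+ L *: y).
Proof.
move=> [ey yL1 yL geny] [U0 Ulin].
have UZ a u : U u -> U (a *: u) by move=> Uu; rewrite -[_ *: _]addr0; apply: Ulin.
have [Uz|] := pselect (forall u, U u -> u = 0).
  by left; apply/seteqP; split=> u /=; [exact: Uz | move=> ->].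
move=> /existsNP[u /not_implyP[Uu u0]]; right.
have [s us] := geny u; have [lam E0] := scale_coef s i.
have ex_k : exists k, (k <= L)%N && ((k < m)%N && (lam k != 0)).
  apply: contrapT => h; apply: u0; rewrite us (E0 _ _ ey) big1 // => k _.
  have [kL|Lk] := leqP k L.
    have [->|lk] := eqVneq (lam k) 0; first by rewrite rmorph0 scale0r.
    by case: h; exists k; rewrite kL lk ltn_ord.
  by rewrite -(subnK Lk) exprD -scalerA yL1 !scaler0.
case: (ex_minnP ex_k) => k /and3P[kL km lk] kmin.
have := UZ (iota (lam k)^-1) _ (UZ (t ^+ (L - k)) _ Uu).
rewrite us (E0 _ _ ey) scaler_sumr (bigD1 (Ordinal km)) //= big1 => [|j].
  rewrite addr0 -iota_scaleC (scalerA (t ^+ _)) -exprD subnK //.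
  by rewrite (scalerA (iota _) (iota _)) -rmorphM mulVf // rmorph1 scale1r.
rewrite -(inj_eq val_inj) /= -iota_scaleC (scalerA (t ^+ _)) -exprD => jk.
have [jk'|kj] := ltnP j k.
  have [->|lj] := eqVneq (lam j) 0; first by rewrite rmorph0 scale0r.
  have := kmin j; rewrite (leq_trans (ltnW jk') kL) lj ltn_ord => /(_ isT).
  by rewrite leqNgt jk'.
have Lj : (L.+1 <= L - k + j)%N by lia.
by rewrite -(subnK Lj) exprD -scalerA yL1 !scaler0.
Qed.

Lemma uniserial_indecomposable M i L : uniserial M i L -> indecomposable M.
Proof.
move=> [y genM]; have [_ _ yL _] := genM; split.
  by exists (t ^+ L *: y).
move=> U V subU subV _ UV0.
have [|Uy] := uniserial_socle genM subU; first by left.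
have [|Vy] := uniserial_socle genM subV; first by right.
have : (U `&` V) (t ^+ L *: y) by [].
by rewrite UV0 => /eqP; rewrite (negbTE yL).
Qed.

(** * Classification of the indecomposable projectives and injectives *)

(** Moving [t] to the left only shifts the idempotents. Hence all elements of t S are nilpotent,
    which replaces the theory of the radical. *)
Lemma mul_t s : exists s', s * t = t * s'.
Proof.
have [lam ->] := spanS X s.
exists (\sum_(i < n) \sum_(k < m) iota (lam i k) * (t ^+ k * e i.+1)).
rewrite mulr_suml mulr_sumr; apply: eq_bigr => i _.
rewrite mulr_suml mulr_sumr; apply: eq_bigr => k _.
rewrite [RHS]mulrA -(iotaC X) -!mulrA -(te X); congr (_ * _).
by rewrite !mulrA -exprS -exprSr.
Qed.

Lemma tS_nilpotent s : (t * s) ^+ m = 0.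
Proof.
suff H k : exists s', (t * s) ^+ k = t ^+ k * s'.
  by have [s' ->] := H m; rewrite (tm X) mul0r.
elim: k => [|k [s' IH]]; first by exists 1; rewrite !expr0 mulr1.
have [s1 s1E] := mul_t s'; exists (s1 * s).
by rewrite exprSr IH -mulrA (mulrA s') s1E -!mulrA mulrA -exprSr.
Qed.

Lemma nilpotent_sub1_inv (N : S) d : N ^+ d = 0 -> exists Q, Q * (1 - N) = 1.
Proof.
move=> Nd; exists (\sum_(k < d) N ^+ k).
rewrite mulr_suml (eq_bigr (fun k : 'I_d => - (N ^+ k.+1 - N ^+ k))).
  rewrite -(big_mkord xpredT (fun k => - (N ^+ k.+1 - N ^+ k))) sumrN telescope_sumr //.
  by rewrite Nd sub0r opprK expr0.
by move=> k _; rewrite opprB mulrBr mulr1 exprSr.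
Qed.

(** If all coordinates lay in t S, then M = t M = t^m M = 0. A component at p outside t S yields a
    split surjection of M onto [S e_p], and indecomposability leaves nothing else. *)
Lemma projective_uniserial M : fin_gen M -> indecomposable M -> projective M ->
  exists p : 'I_n, uniserial M p (plength p).-1.
Proof.
move=> fgM [[x0 x0N] indM] /(dual_basis fgM) [d [g [phi phiE]]].
have [x [i [p tS]]] : exists x i (p : 'I_n), ~ exists s, phi i x * e p = t * s.
  apply: contrapT => h; case/eqP: x0N.
  have tM (u : M) : exists y, u = t *: y.
    have /choice [F FE] i : exists s, phi i u = t * s.
      have /choice [F FE] (p : 'I_n) : exists s, phi i u * e p = t * s.
        by apply: contrapT => hp; apply: h; exists u, i, p.
      exists (\sum_p F p); rewrite -[LHS]mulr1 -(e_sum X) !mulr_sumr.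
      by apply: eq_bigr.
    exists (\sum_i F i *: g i); rewrite {1}(phiE u) scaler_sumr; apply: eq_bigr => i _.
    by rewrite FE scalerA.
  have tkM k : exists y, x0 = t ^+ k *: y.
    elim: k => [|k [y ->]]; first by exists x0; rewrite expr0 scale1r.
    by have [y' ->] := tM y; exists y'; rewrite scalerA -exprSr.
  by have [y ->] := tkM m; rewrite (tm X) scale0r.
have [lam E0] := mul_e_coef (phi i x) p.
have m_gt0 : (0 < m)%N := leq_trans (plength_gt0 0) (plength_le_m 0).
pose r := \sum_(k < m | k != Ordinal m_gt0) iota (lam k) * (t ^+ k.-1 * e p).
have {}E0 : phi i x * e p = iota (lam 0%N) * e p + t * r.
  rewrite E0 (bigD1 (Ordinal m_gt0)) //= expr0 mul1r; congr (_ + _).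
  rewrite mulr_sumr; apply: eq_bigr => k; rewrite -(inj_eq val_inj) /= -lt0n => k0.
  by rewrite [RHS]mulrA -(iotaC X) -mulrA (mulrA t) -exprS prednK.
have l0 : lam 0%N != 0.
  by apply/eqP => l0; apply: tS; exists r; rewrite E0 l0 rmorph0 mul0r add0r.
pose w := e p * (phi i x * e p).
have wE : w = iota (lam 0%N) * e p + t * (e p.+1 * r).
  by rewrite /w E0 mulrDr mulrA -(iotaC X) -mulrA e_idem mulrA -(te X) mulrA.
(* On [S e_p], [w] is a nonzero scalar up to t S; inverting [1 - N] by a geometric series gives a
   left multiple of [w] equal to [e p]. *)
pose N := e p - iota (lam 0%N)^-1 * w.
have NE : N = t * - (iota (lam 0%N)^-1 * (e p.+1 * r)).
  rewrite /N wE mulrDr mulrA -rmorphM mulVf // rmorph1 mul1r opprD addrA subrr add0r.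
  by rewrite mulrN !mulrA (iotaC X _ t).
have [Q QN] : exists Q, Q * (1 - N) = 1.
  by apply: (@nilpotent_sub1_inv N m); rewrite NE tS_nilpotent.
have wep : w * e p = w by rewrite /w -!mulrA e_idem.
have Qw : Q * iota (lam 0%N)^-1 * w = e p.
  rewrite -[RHS]mul1r -QN -!mulrA mulrBl mul1r /N mulrBl e_idem -mulrA wep.
  by rewrite opprB addrCA subrr addr0.
have [psi psiE] : exists psi : {linear M -> S^o}, forall u, psi u = phi i u * e p.
  apply: (@linear_of_graph _ M S^o (fun u y => y = phi i u * e p)).
  - by move=> u; eexists.
  - by move=> a u _ u' _ -> ->; rewrite linearP mulrDl -mulrA.
  - by move=> _ ->; rewrite linear0 mul0r.
pose z := (e p * (Q * iota (lam 0%N)^-1 * e p)) *: x.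
have ez : e p *: z = z by rewrite scalerA mulrA e_idem.
have psiz : psi z = e p.
  rewrite psiE linearZ /= -[_ *: _]/(_ * _ : S) -!mulrA -/w.
  by rewrite (mulrA Q) Qw e_idem.
have psi_e u : psi u * e p = psi u by rewrite psiE -mulrA e_idem.
have psis s : psi (s *: z) = s * e p by rewrite linearZ /= psiz.
have [||||Uz|kerz] := indM (fun u => exists s, u = s *: z) (fun u => psi u = 0).
- split; first by exists 0; rewrite scale0r.
  move=> a _ _ [s ->] [s' ->]; exists (a * s + s').
  by rewrite scalerDl scalerA.
- split; first exact: linear0.
  by move=> a u v hu hv; rewrite linearP /= hu hv addr0 /GRing.scale /= mulr0.
- move=> u; exists (psi u *: z); first by eexists.
  exists (u - psi u *: z); last by rewrite addrC subrK.
  by rewrite linearB psis psi_e subrr.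
- apply/seteqP; split=> u /=; last first.
    by move=> ->; split; [exists 0; rewrite scale0r | exact: linear0].
  move=> [[s ->]]; rewrite psis => se; by rewrite -ez scalerA se scale0r.
- have z0 : [set 0] z by rewrite -Uz; exists 1; rewrite scale1r.
  by have := e_neq0 X p; rewrite -psiz (z0 : z = 0) linear0 eqxx.
have ker0 u : psi u = 0 -> u = 0.
  by move=> hu; have : [set 0] u by rewrite -kerz.
exists p, z; split=> //.
- by apply: ker0; rewrite psis prednK ?plength_gt0 // tXe_plength.
- apply/eqP => z0; have /eqP := psis (t ^+ (plength p).-1).
  rewrite z0 linear0 eq_sym; apply/negP/tXe_neq0.
  by rewrite prednK // plength_gt0.
move=> u; exists (psi u); apply/eqP; rewrite -subr_eq0; apply/eqP/ker0.
by rewrite linearB psis psi_e subrr.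
Qed.

Lemma uniserial_submodule M i L (z : M) :
  e i *: z = z -> t ^+ L *: z != 0 -> t ^+ L.+1 *: z = 0 ->
  exists (P : lmodType S) (f : {linear P -> M}),
    [/\ injective f, forall u, (exists v, f v = u) <-> exists a, u = a *: z
      & uniserial P i L].
Proof.
move=> ez zL zL1; pose U (u : M) := exists a, u = a *: z.
have subU : submodule U.
  split; first by exists 0; rewrite scale0r.
  by move=> a _ _ [c ->] [c' ->]; exists (a * c + c'); rewrite scalerDl scalerA.
pose P : lmodType S := submodule_type subU.
pose f : {linear P -> M} := @incl _ _ _ subU.
have injf : injective f by apply: incl_inj.
have [z' fz'] : exists z' : P, f z' = z by apply: incl_surj; exists 1; rewrite scale1r.
exists P, f; split=> // [u|].
  by split=> [[v <-]|]; [exact: (inclP v) | exact: (incl_surj subU)].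
exists z'; split.
- by apply: injf; rewrite linearZ /= fz'.
- by apply: injf; rewrite linearZ /= fz' zL1 linear0.
- by apply: contraNneq zL => z0; rewrite -fz' -linearZ /= z0 linear0.
by move=> u; have [a aE] := inclP u; exists a; apply: injf; rewrite linearZ /= fz'.
Qed.

(** Divisibility puts a socle vector at the bottom of a submodule of length [hull b]. That submodule
    is itself injective, so it splits off and is all of M. *)
Lemma injective_uniserial M : fin_gen M -> indecomposable M -> injective_module M ->
  exists b L, uniserial M (b + L.+1) L /\ L.+1 = hull b.
Proof.
move=> fgM [[x0 x0N] indM] injM; have divM := injective_divisible injM.
have [i x1N] : exists i : 'I_n, e i *: x0 != 0.
  apply: contrapT => h; case/eqP: x0N; rewrite (sum_e x0) big1 // => i _.
  by apply/eqP; apply: contraT => hi; case: h; exists i.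
pose x1 := e i *: x0; have ex1 : e i *: x1 = x1 by rewrite scalerA e_idem.
have ex_r : exists r, t ^+ r.+1 *: x1 == 0 by exists m;
  rewrite exprS (tm X) mulr0 scale0r.
case: (ex_minnP ex_r) => r /eqP tr rmin.
pose s := t ^+ r *: x1.
have sN : s != 0.
  rewrite /s; case: r rmin {tr s} => [|r] rmin; first by rewrite expr0 scale1r.
  by apply/negP => /rmin; rewrite ltnn.
have ts : t *: s = 0 by rewrite scalerA -exprS.
(* This is i - r - 1 modulo n: the vertex of [s] is one above the bottom b. *)
pose b := (i + n.-1 * r + n.-1)%N.
have bi : (b.+1 + r)%N = i %[mod n].
  rewrite /b -addnS prednK // -addnA (addnC n) addnA -(addnA i) -mulSnr prednK //.
  by rewrite modnDr addnC mulnC modnMDl.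
have es : e b.+1 *: s = s by apply: scale_tXe; rewrite (e_mod bi).
pose L := (hull b).-1; have LE : L.+1 = hull b by rewrite prednK // hull_gt0.
have [|z ez tz] := divM b.+1 L s es.
- have -> : (plength (b.+1 + L) - L = (plength (b + hull b) - L.+1).+1)%N.
    by have := hull_le b; rewrite -LE addSnnS; lia.
  by rewrite exprSr -scalerA ts scaler0.
have [P [f [injf fP uP]]] : exists (P : lmodType S) (f : {linear P -> M}),
    [/\ injective f, forall u, (exists v, f v = u) <-> exists a, u = a *: z
      & uniserial P (b + L.+1) L].
  apply: uniserial_submodule; first by rewrite -addSnnS.
    by rewrite tz.
  by rewrite exprS -scalerA tz.
have injP : injective_module P := uniserial_injective uP LE.
have [h hE] := injP P M f idfun (uniserial_fin_gen uP) fgM injf.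
have {}hE v : h (f v) = v by apply: hE.
have h_sub u : h (u - f (h u)) = 0 by rewrite linearB hE subrr.
have [||||Uz|kerz] := indM (fun u => exists a, u = a *: z) (fun u => h u = 0).
- split; first by exists 0; rewrite scale0r.
  by move=> a _ _ [c ->] [c' ->]; exists (a * c + c'); rewrite scalerDl scalerA.
- split; first exact: linear0.
  by move=> a u v hu hv; rewrite linearP /= hu hv addr0 scaler0.
- move=> u; exists (f (h u)); first by apply/fP; exists (h u).
  by exists (u - f (h u)) => //; rewrite addrC subrK.
- apply/seteqP; split=> u /=; last first.
    by move=> ->; split; [exists 0; rewrite scale0r | exact: linear0].
  by move=> [/fP[v <-]]; rewrite hE => ->; rewrite linear0.
- have z0 : [set 0] z by rewrite -Uz; exists 1; rewrite scale1r.
  by case/eqP: sN; rewrite -tz (z0 : z = 0) scaler0.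
exists b, L; split=> //; exists z; split.
- by rewrite -addSnnS.
- by rewrite exprS -scalerA tz.
- by rewrite tz.
move=> u; have : [set 0] (u - f (h u)) by rewrite -kerz.
move=> /eqP; rewrite subr_eq0 => /eqP ->; apply/fP; by exists (h u).
Qed.

(** * The regular module as a sum of chains *)

Local Notation pbot := (pbot plength m).
Local Notation ptop := (ptop m).
Local Notation noninj := (noninj_tops plength n m).

Lemma pbot_plength (p : 'I_n) : (pbot p + plength p)%N = ptop p.
Proof. exact: pbotK plength_le_m p. Qed.

Lemma e_ptop (p : 'I_n) : e (ptop p) = e p.
Proof. by apply: e_mod; apply: ptop_mod. Qed.

Lemma regular_basis :
  chain_basis (setT : set S^o) (fun p : 'I_n => pbot p) (fun p => plength p)
    (fun p h => t ^+ (plength p - h) * e p).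
Proof.
have cY : chain (M := S^o) (fun p : 'I_n => pbot p) (fun p => plength p)
    (fun p h => t ^+ (plength p - h) * e p).
  split=> [p|p h hp|p h hp]; first by rewrite subn0 tXe_plength.
    by rewrite -[_ *: _]/(_ * _ : S) mulrA -exprS subnSK.
  apply: (@scale_tXe S^o); rewrite -addnA subnKC // pbot_plength e_ptop.
  exact: e_idem.
have [_ spanP] := chain_submodule cY.
split=> //.
  apply: (chain_free_socle cY) => mu mu0 p _.
  have := congr1 (fun s : S => s * e p) mu0;
    rewrite mul0r mulr_suml (bigD1 p) ?plength_gt0 //=.
  rewrite [X in _ + X]big1 => [|q /andP[_ qp]]; last first.
    rewrite -[_ *: _]/(_ * _ : S) -!mulrA eM !modn_small ?ltn_ord //.
    by rewrite (inj_eq val_inj) (negbTE qp) !mulr0.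
  rewrite addr0 -[_ *: _]/(_ * _ : S) -!mulrA e_idem => h.
  have [//|] := @iota_scale_eq0 S^o _ _ h => /eqP.
  by rewrite (negbTE (tXe_neq0 _)) // subn1 prednK // plength_gt0.
move=> s; split=> // _; rewrite -[s]mulr1 -(e_sum X).
rewrite mulr_sumr; elim/big_ind: _ => [|u v [lu ->] [lv ->]|p _].
- by exists (fun _ _ => 0); rewrite comb0.
- by rewrite combD; eexists.
have [lam pE] := chain_comb (a := p) cY (leqnn (plength p)).
have := spanP s _ _ (ex_intro _ lam pE) (ex_intro _ (fun _ _ => 0) (esym (comb0 _ _))).
by rewrite subnn expr0 mul1r addr0.
Qed.

Lemma noninj_neq0 : ~ injective_module S^o -> noninj != finset.set0.
Proof.
move=> ninj; apply/eqP => B0; apply/ninj/divisible_injective.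
apply: (hull_divisible regular_basis) => p; apply/eqP.
have : p \notin noninj by rewrite B0 finset.inE.
by rewrite finset.inE negbK eq_sym.
Qed.

(** * Terms of a minimal injective coresolution *)

Section Coresolution.
Variables (M : lmodType S) (c : min_inj_coresolution M).

Definition cores_image j : set (cores_obj c j) :=
  match j with 0 => range (cores_aug c) | i.+1 => range (cores_diff c i) end.

Lemma cores_image_essential j : essential (@cores_image j).
Proof. by case: j => [|j]; [exact: cores_essential0 | exact: cores_essentialS]. Qed.

Lemma cores_image_ker j u : cores_diff c j u = 0 <-> cores_image u.
Proof. by case: j u => [|j] u; [exact: cores_exact0 | exact: cores_exactS]. Qed.

Lemma chain_basis_image N (f : {linear M -> N}) (T : finType) x l (Y : T -> nat -> M) :
  injective f -> chain_basis setT x l Y ->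
    chain_basis (range f) x l (fun a h => f (Y a h)).
Proof.
move=> injf [[Y0 tY eY] free sp].
have combE lam : comb l (fun a h => f (Y a h)) lam = f (comb l Y lam).
  rewrite linear_sum; apply: eq_bigr => a _; rewrite linear_sum; apply: eq_bigr => h _.
  by rewrite linearZ.
split; first split.
- by move=> a; rewrite Y0 linear0.
- by move=> a h hl; rewrite -linearZ /= tY.
- by move=> a h hl; rewrite -linearZ /= eY.
- move=> lam; rewrite combE => f0; apply: free; apply: injf; by rewrite f0 linear0.
move=> u; split=> [[v _ <-]|[lam ->]]; last by rewrite combE; eexists.
by have [lam ->] := (sp v).1 I; exists lam; rewrite combE.
Qed.

Variables (T : finType) (x l : T -> nat) (Y : T -> nat -> M).
Hypothesis basM : chain_basis setT x l Y.

Local Notation cseq a := (cores_seq plength m (x a) (x a + l a)).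
Local Notation proj := (proj_bot plength m).

Lemma cseq_lt a k : (0 < l a)%N -> (l a < hull (x a))%N ->
  (forall i, (i < k)%N -> proj (cseq a i)) -> (cseq a k < cseq a k.+1)%N.
Proof.
move=> la lh; apply: (cores_seq_lt n_gt0 plength_le_m); last by rewrite ltn_add2l.
by rewrite -{1}[x a]addn0 ltn_add2l.
Qed.

(** All chains are carried along, since essentiality concerns the whole image. The position of one
    is recorded only while the preceding terms are bottoms of projectives: this ensures that it is
    nonempty, so that the next hull follows g. *)
Lemma cores_stage j : exists (xj lj : T -> nat) (Yj : T -> nat -> cores_obj c j),
  chain_basis (@cores_image j) xj lj Yj /\
  forall a, (0 < l a)%N -> (l a < hull (x a))%N ->
    (forall i, (i < j)%N -> proj (cseq a i)) ->
    xj a = cseq a j /\ (xj a + lj a)%N = cseq a j.+1.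
Proof.
elim: j => [|j [xj [lj [Yj [bas seqE]]]]].
  exists x, l, (fun a h => cores_aug c (Y a h)); split=> //.
  exact: chain_basis_image (@cores_aug_inj _ _ c) basM.
have divE := injective_divisible (@cores_injective _ _ c j).
have [Z [basZ ZY]] := hull_basis divE (@cores_image_essential j) bas.
have lL a := hull_lens_le bas a.
have bas' := cosyzygy_basis bas basZ lL ZY (@cores_image_ker j).
exists (fun a => xj a + lj a)%N, (fun a => hull_lens xj lj a - lj a)%N.
exists (fun a h => cores_diff c j (Z a (lj a + h)%N)); split=> // a la lh pj.
have [xE xlE] := seqE a la lh (fun i ij => pj i (ltnW ij)).
have lt : (cseq a j < cseq a j.+1)%N.
  apply: (cseq_lt la lh) => i ij; apply: pj; exact: ltnW.
split=> //; rewrite cores_seqSS -addnA subnKC //.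
rewrite /hull_lens (_ : lj a == 0%N = false); last by apply/negbTE; lia.
by rewrite xE.
Qed.

Lemma cores_stage_hull j a : (0 < l a)%N -> (l a < hull (x a))%N ->
  (forall i, (i < j)%N -> proj (cseq a i)) ->
  exists z : cores_obj c j, exists L, [/\ L.+1 = hull (cseq a j),
    e (cseq a j + L.+1)%N *: z = z, t ^+ L *: z != 0 & t ^+ L.+1 *: z = 0].
Proof.
move=> la lh pj; have [xj [lj [Yj [bas seqE]]]] := cores_stage j.
have [xE xlE] := seqE a la lh pj.
have divE := injective_divisible (@cores_injective _ _ c j).
have [Z [[cZ freeZ _] _]] := hull_basis divE (@cores_image_essential j) bas.
have lt : (cseq a j < cseq a j.+1)%N.
  exact: cseq_lt.
have LE : hull_lens xj lj a = hull (cseq a j).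
  by rewrite /hull_lens (_ : lj a == 0%N = false) ?xE //; apply/negbTE; lia.
have L1 : (hull (cseq a j)).-1.+1 = hull (cseq a j) by rewrite prednK // hull_gt0.
exists (Z a (hull (cseq a j))), (hull (cseq a j)).-1; split=> //.
- have [_ _ eZ] := cZ; have := eZ a (hull (cseq a j)).-1.
  by rewrite L1 xE LE; apply.
- rewrite (chain_tX _ cZ) ?LE // -{1}L1 subSnn.
  by apply: (chain_free_neq0 freeZ); rewrite LE hull_gt0.
- rewrite L1 (chain_tX _ cZ) ?LE // subnn.
  by case: cZ.
Qed.

Lemma cores_proj a k : (0 < l a)%N -> (l a < hull (x a))%N ->
  (forall i, (i <= k)%N -> projective (cores_obj c i)) -> proj (cseq a k).
Proof.
move=> la lh; elim/ltn_ind: k => k IH pk.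
have [i ik|z [L [LE ez zL zL1]]] := @cores_stage_hull k a la lh.
  by apply: IH => // j ji; apply/pk/(leq_trans ji)/ltnW.
exact: projective_proj_bot (@cores_fin_gen _ _ c k) (pk k (leqnn k)) ez zL zL1.
Qed.

End Coresolution.

(** * Dominant dimensions and defect *)

Local Notation tseq p := (cores_seq plength m (pbot p) (ptop p)).
Local Notation proj := (proj_bot plength m).

Variable R : realType.

Definition injnonproj M :=
  [/\ fin_gen M, indecomposable M, injective_module M & ~ projective M].
Definition projnoninj M :=
  [/\ fin_gen M, indecomposable M, projective M & ~ injective_module M].

Lemma cores_domdim_le M (c : min_inj_coresolution M) k :
  ~ projective (cores_obj c k) -> (cores_domdim R c <= k%:R%:E)%E.
Proof.
move=> nk; rewrite /cores_domdim; case: asboolP => p0; last by rewrite lee_fin ler0n.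
case: k nk => [//|k] nk.
rewrite -natr1 EFinD; apply: leeD2r; apply: ge_ereal_sup => _ [j pj <-].
rewrite lee_fin ler_nat leqNgt; apply/negP => kj; exact: nk (pj _ kj).
Qed.

Lemma exists_proj_index : exists D : 'I_n -> nat, forall p, p \in noninj ->
  ~~ proj (tseq p (D p)) /\ forall k, (k < D p)%N -> proj (tseq p k).
Proof.
suff /choice[D DP] (p : 'I_n) : exists d, p \in noninj ->
    ~~ proj (tseq p d) /\ forall k, (k < d)%N -> proj (tseq p k) by exists D.
have [pB|] := boolP (p \in noninj); last by exists 0%N.
have exk := cores_seq_not_proj n_gt0 plength_per plengthS plength_le_m pB.
case: (ex_minnP exk) => d nd dmin; exists d => _; split=> // k.
by rewrite ltnNge; apply: contraNT => /dmin.
Qed.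

Section ProjIndex.
Variable D : 'I_n -> nat.
Hypothesis DP : forall p, p \in noninj ->
  ~~ proj (tseq p (D p)) /\ forall k, (k < D p)%N -> proj (tseq p k).

Lemma proj_index_sum : noninj != finset.set0 -> (\sum_(p in noninj) D p <= 2 * n - 2)%N.
Proof.
apply: (noninj_tops_sum_bound n_gt0 plength_per plengthS plength_le_m) => p k pB.
have [_ Dp] := DP pB; rewrite leqNgt; apply: contra; exact: Dp.
Qed.

Lemma hull_noninj (p : 'I_n) : p \in noninj -> (plength p < hull (pbot p))%N.
Proof.
rewrite finset.inE => pB; rewrite ltn_neqAle eq_sym pB /=.
exact: hull_len_pbot n_gt0 plength_per plength_le_m p.
Qed.

Lemma cores_domdim_noninj M (c : min_inj_coresolution M) (T : finType) x l
    (Y : T -> nat -> M) a p :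
  chain_basis setT x l Y -> x a = pbot p -> l a = plength p -> p \in noninj ->
  (cores_domdim R c <= (D p)%:R%:E)%E.
Proof.
move=> bas xa la pB; have [nD _] := DP pB.
have [i iD ni] : exists2 i, (i <= D p)%N & ~ projective (cores_obj c i).
  apply: contrapT => h; case/negP: nD; rewrite -pbot_plength -xa -la.
  apply: (@cores_proj _ c _ _ _ _ bas);
    rewrite ?la ?xa ?plength_gt0 ?hull_noninj // => i iD.
  by apply: contrapT => ni; apply: h; exists i.
by apply: le_trans (cores_domdim_le ni) _; rewrite lee_fin ler_nat.
Qed.

Lemma domdim_noninj M (T : finType) x l (Y : T -> nat -> M) a p :
  chain_basis setT x l Y -> x a = pbot p -> l a = plength p -> p \in noninj ->
  (domdim R M <= (D p)%:R%:E)%E.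
Proof.
move=> bas xa la pB; apply: ge_ereal_sup => _ [c ->].
exact: cores_domdim_noninj bas xa la pB.
Qed.

Lemma projnoninj_uniserial M : projnoninj M ->
  exists2 p : 'I_n, p \in noninj & uniserial M p (plength p).-1.
Proof.
move=> [fgM indM projM ninj]; have [p up] := projective_uniserial fgM indM projM.
exists p => //; rewrite finset.inE; apply/eqP => hp; apply: ninj.
have pl : (plength p).-1.+1 = plength p by rewrite prednK // plength_gt0.
apply: (@uniserial_injective _ (pbot p) (plength p).-1); last by rewrite pl.
apply: uniserial_mod up; rewrite pl pbot_plength; exact/esym/ptop_mod.
Qed.

Lemma projnoninj_sum_le : ~ injective_module S^o ->
  (iso_classes_sum projnoninj (@domdim S R) <= (2 * n - 2)%:R%:E)%E.
Proof.
move=> /noninj_neq0 B0; apply: ge_ereal_sup => _ [d [F [[FP Finj] ->]]].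
have /choice [p pP] i : exists p : 'I_n, p \in noninj /\ uniserial (F i) p (plength p).-1.
  by have [p pB up] := projnoninj_uniserial (FP i); exists p.
have injp : injective p.
  move=> i j e; apply: Finj; have [_ ui] := pP i; have [_ uj] := pP j.
  by rewrite e in ui; apply: (uniserial_iso ui uj).
apply: (@le_trans _ _ (\sum_(i < d) (D (p i))%:R%:E)%E).
  apply: lee_sum => i _; have [pB up] := pP i.
  have pl : (plength (p i)).-1.+1 = plength (p i) by rewrite prednK // plength_gt0.
  have [|Y bas] := @uniserial_basis (F i) (pbot (p i)) (plength (p i)).-1.
    apply: uniserial_mod up; rewrite pl pbot_plength; exact/esym/ptop_mod.
  exact: (domdim_noninj (a := tt) bas _ _ pB).
rewrite sumEFin -natr_sum lee_fin ler_nat (leq_trans _ (proj_index_sum B0)) //.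
rewrite -(big_imset D (in2W injp)) /= big_mkcond [leqRHS]big_mkcond.
apply: leq_sum => q _; case: imsetP => // -[i _ ->].
by have [-> _] := pP i.
Qed.

(** The module is found inside the term of index [D p]: it is the longest interval over a bottom
    that belongs to no projective. *)
Lemma exists_injnonproj (c : min_inj_coresolution S^o) p : p \in noninj ->
  exists M, injnonproj M.
Proof.
move=> pB; have [nD Dp] := DP pB.
have [|z [L [LE ez zL zL1]]] :=
  cores_stage_hull c regular_basis (plength_gt0 p) (hull_noninj pB) (j := D p).
  by rewrite pbot_plength.
have [P [f [_ _ uP]]] := uniserial_submodule ez zL zL1.
exists P; split.
- exact: uniserial_fin_gen uP.
- exact: uniserial_indecomposable uP.
- exact: uniserial_injective uP LE.
by apply: (uniserial_not_projective uP); rewrite pbot_plength.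
Qed.

End ProjIndex.

Lemma injnonproj_uniserial M : injnonproj M ->
  exists b L, [/\ uniserial M (b + L.+1) L, L.+1 = hull b & ~~ proj b].
Proof.
move=> [fgM indM injM nproj]; have [b [L [uM LE]]] := injective_uniserial fgM indM injM.
exists b, L; split=> //; apply/negP => pb; apply: nproj.
by apply: (uniserial_projective uM); rewrite {1}LE -(eqP pb) /hull_top LE.
Qed.

(** The bottom modulo n determines an indecomposable injective. The residues that are not bottoms of
    projectives are as many as the non-injective projectives, by [card_noninj_tops]. *)
Lemma iso_distinct_injnonproj d (F : 'I_d -> lmodType S) :
  iso_distinct injnonproj F -> (d <= #|noninj|)%N.
Proof.
move=> [FP Finj].
have /choice [b /choice[L bP]] i := injnonproj_uniserial (FP i).
have injb : injective (fun i => modI n_gt0 (b i)).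
  move=> i j /modI_eq e; apply: Finj; have [ui Li _] := bP i; have [uj Lj _] := bP j.
  have Lij : L i = L j by apply: succn_inj; rewrite Li Lj;
    apply: (hull_len_mod _ plength_per).
  rewrite Lij in ui; apply: (uniserial_iso ui uj).
  by rewrite -modnDml e modnDml.
rewrite (card_noninj_tops n_gt0 plength_per plengthS plength_le_m) -[d]card_ord.
rewrite -(card_imset _ injb); apply/subset_leq_card/fintype.subsetP => q /imsetP[i _ ->].
by rewrite finset.inE (modI_proj_bots _ n_gt0 plength_per); have [] := bP i.
Qed.

Lemma defect_bounds M : injnonproj M ->
  exists r : R, [/\ iso_classes_card R injnonproj = r%:E, 1 <= r & r <= #|noninj|%:R].
Proof.
move=> MP.
have ub : (iso_classes_card R injnonproj <= #|noninj|%:R%:E)%E.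
  apply: ge_ereal_sup => _ [d [F [FP ->]]].
  by rewrite lee_fin ler_nat; apply: iso_distinct_injnonproj FP.
have lb : (1%:E <= iso_classes_card R injnonproj)%E.
  apply: ereal_sup_ubound; exists 1%N, (fun=> M); split=> //; split=> // i j _.
  by rewrite !ord1.
case: (iso_classes_card R injnonproj) ub lb => [r| |] //; rewrite !lee_fin => ub lb.
by exists r.
Qed.

(** The value -oo covers the absence of coresolutions. Otherwise [q] is the least [D p]: every
    non-injective projective is a summand of the regular module, so each [D p] bounds its dominant
    dimension, and the least one times their number is at most the sum. *)
Lemma domdim_defect_bounds : ~ injective_module S^o ->
  domdim R (S^o : lmodType S) = -oo%E \/
  exists (q : nat) (r : R), [/\ (domdim R (S^o : lmodType S) <= q%:R%:E)%E,
    iso_classes_card R injnonproj = r%:E, 1 <= r & (q%:R * r <= (2 * n - 2)%:R)] /\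
    ((n <= q)%N -> r = 1).
Proof.
move=> ninj; have B0 := noninj_neq0 ninj.
have [[c _]|noc] := pselect (exists c : min_inj_coresolution S^o, True); last first.
  left; rewrite /domdim (_ : [set d | _] = set0) ?ereal_sup0 //.
  by apply/seteqP; split=> // d [c _]; case: noc; exists c.
right; have [D DP] := exists_proj_index; have [p0 p0B] := finset.set0Pn _ B0.
have [M MP] := exists_injnonproj DP c p0B.
have [r [rE r1 rB]] := defect_bounds MP.
case: (arg_minnP D p0B) => p pB pmin.
have Dle : (D p * #|noninj| <= 2 * n - 2)%N.
  apply: leq_trans (proj_index_sum DP B0).
  by rewrite mulnC -sum_nat_const; apply: leq_sum => q /pmin.
exists (D p), r; split; first split=> //.
- exact: (domdim_noninj DP (a := p) regular_basis).
- apply: (@le_trans _ _ ((D p)%:R * #|noninj|%:R)); first by rewrite ler_wpM2l.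
  by rewrite -natrM ler_nat.
move=> nD; apply/eqP; rewrite eq_le r1 andbT (le_trans rB) // (ler_nat _ _ 1).
(* Two non-injective projectives would give 2 n <= 2 n - 2. *)
rewrite leqNgt; apply/negP => B2.
have : (n * 2 <= D p * #|noninj|)%N by apply: leq_mul.
by have := n_gt0; lia.
Qed.

End Modules.
End NakayamaRing.

(** * Nakayama algebras *)

(* The monomials are hidden behind an existential quantifier because unification
   is very slow when it can unfold them. *)
Lemma path_monomials (K : nzRingType) (Q : quiver) :
  exists u : option (qpath Q) -> path_algebra K Q,
    [/\ u None = 0, forall p q, u p * u q = u (obind (fun p' =>
      obind (Defs.pcomp p') q) p),
        \sum_v u (Some (trivial_path v)) = 1,
        forall x, x = \sum_(p <- msupp x) pcoeff x p *: u (Some p)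
      & forall p q, q \in msupp (u (Some p)) = (q == p)].
Proof.
exists (pmonom 1); split=> //.
- by move=> p q; rewrite pa_mulE pa_mulOO mulr1.
- move=> x; rewrite {1}(pmonomE x); apply: eq_bigr => p _.
  by rewrite pmonomZ mulr1.
- by move=> p q; rewrite /pmonom msuppU oner_eq0 inE.
Qed.

(** * The line and the cycle treated together *)

Section QuiverRing.
Variables (K : fieldType) (n : nat) (Ar : finType) (src tgt : Ar -> 'I_n).
Hypotheses (src_inj : injective src) (tgtE : forall a, tgt a = ordS (src a)).
Local Notation Q := (Quiver src tgt).
Local Notation KQ := (path_algebra K Q).

Definition arrow_path (a : Ar) : qpath Q :=
  @QPath Q (src a, [:: a]) (introT andP (conj (eqxx _) isT)).

Lemma arrow_pathK (q : qpath Q) a : psrc q = tgt a -> exists r : qpath Q,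
  [/\ Defs.pcomp (arrow_path a) q = Some r, r.1 = src a & r.2 = a :: q.2].
Proof. by move=> e; have [r [-> r1 r2]] :=
  pcompP (esym e : ptgt (arrow_path a) = psrc q); exists r. Qed.

Lemma qpath_eq (p q : qpath Q) : p.1 = q.1 -> p.2 = q.2 -> p = q.
Proof. by move=> e1 e2; apply: val_inj;
  case: p q e1 e2 => [[? ?] ?] [[? ?] ?] /= -> ->. Qed.

(** At most one arrow leaves each vertex, so a path is determined by its start and length and equals
    [e i * t ^+ k]. The last two clauses make [t] nilpotent and the idempotents nonzero in an
    admissible quotient. *)
Lemma path_generators :
  exists (e : 'I_n -> KQ) (t : KQ),
    [/\ [/\ forall i j, e i * e j = if i == j then e i else 0, \sum_i e i = 1
          & forall i, e i * t = t * e (ordS i)],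
        forall P : KQ -> Prop, P 0 -> (forall x y, P x -> P y -> P (x + y)) ->
          (forall a i k, P (a *: (e i * t ^+ k))) -> forall x, P x,
        forall d i, @arrow_ideal_pow K Q d (e i * t ^+ d)
      & forall i, ~ @arrow_ideal_pow K Q 2 (e i)].
Proof.
have [u [uN uM u1 ux usupp]] := path_monomials K Q.
pose e (i : 'I_n) := u (Some (@trivial_path Q i));
  pose t := \sum_a u (Some (arrow_path a)).
have eu i p : e i * u (Some p) = if i == psrc p then u (Some p) else 0.
  by rewrite /e uM /= pcomp1; case: ifP.
have ue i p : u (Some p) * e i = if i == ptgt p then u (Some p) else 0.
  by rewrite /e uM /= pcomp1r; case: ifP.
have ee i j : e i * e j = if i == j then e i else 0.
  by rewrite {2}/e eu /psrc /=; case: eqP => // ->.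
have ete i : e i * t = t * e (ordS i).
  rewrite mulr_sumr mulr_suml; apply: eq_bigr => a _.
  by rewrite eu ue /psrc /ptgt /= tgtE (inj_eq (@ordS_inj n)).
have et a : e (src a) * t = u (Some (arrow_path a)).
  rewrite mulr_sumr (bigD1 a) //= big1 => [|b ba]; first by rewrite eu eqxx addr0.
  by rewrite eu /psrc /= (inj_eq src_inj) eq_sym (negbTE ba).
have uE p : u (Some p) = e (psrc p) * t ^+ plen p.
  case: p => [[v s] w]; rewrite /psrc /plen /=.
  elim: s v w => [|a s IH] v w.
    by rewrite expr0 mulr1 /e; congr (u (Some _)); apply: val_inj.
  have /andP[/eqP /= av ws] := w.
  pose q : qpath Q := @QPath Q (tgt a, s) ws.
  have [r [rE r1 r2]] := @arrow_pathK q a erefl.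
  have -> : QPath w = r by apply: qpath_eq; rewrite ?r1 ?r2.
  rewrite [size _]/= -[in RHS]av exprS mulrA et
    (_ : t ^+ size s = \sum_i e i * t ^+ size s); last first.
    by rewrite -mulr_suml u1 mul1r.
  rewrite mulr_sumr (bigD1 (tgt a)) //= big1 ?addr0 => [|i ia].
    by rewrite -(IH _ ws) uM /= rE.
  by rewrite mulrA ue /ptgt /= (negbTE ia) mul0r.
(* The product vanishes when a path on the line would run beyond the last vertex. *)
have etX d i : e i * t ^+ d = 0 \/ exists p : qpath Q, [/\ plen p = d, psrc p = i
  & e i * t ^+ d = u (Some p)].
  elim: d i => [|d IH] i.
    by right; exists (@trivial_path Q i); split; rewrite // expr0 mulr1.
  have [[a ai]|na] := pselect (exists a, src a = i); last first.
    left; rewrite exprS mulrA mulr_sumr big1 ?mul0r // => a _.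
    by rewrite eu /psrc /=; case: eqP => // ia; case: na; exists a.
  have -> : e i * t ^+ d.+1 = u (Some (arrow_path a)) * (e (tgt a) * t ^+ d).
    by rewrite exprS !mulrA -ai et ue /ptgt /= eqxx.
  have [->|[p [pd pa ->]]] := IH (tgt a); first by left; rewrite mulr0.
  right; have [r [rE r1 r2]] := arrow_pathK pa; exists r.
  by rewrite /plen /psrc r1 r2 /= -/(plen p) pd uM /= rE.
exists e, t; split.
- by split.
- move=> P P0 PD PZ x; rewrite (ux x); elim/big_ind: _ => // p _.
  by rewrite uE; apply: PZ.
- move=> d i p; have [->|[q [qd _ ->]]] := etX d i; first by rewrite msupp0.
  by rewrite usupp => /eqP ->; rewrite qd.
- move=> i /(_ (@trivial_path Q i)); rewrite /e usupp eqxx => /(_ isT).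
  by [].
Qed.
Lemma quiver_nakayama_ring (A : falgType K) : (0 < n)%N -> quiver_algebra Q A ->
  inhabited (nakayama_ring K A^c n).
Proof.
move=> n_gt0 [I [phi [[[I0 ID _] [d [d2 Jd IJ]]] [phi1 phiM] phi_surj phiI]]].
have [e [t [[ee e1 et] ind Jt Je]]] := path_generators.
have phiX x k : phi (x ^+ k) = phi x ^+ k.
  by elim: k => [|k IH]; rewrite ?expr0 // !exprS phiM IH.
have td : phi t ^+ d = 0.
  rewrite -phiX -[t ^+ d]mul1r -e1 mulr_suml linear_sum big1 // => i _.
  exact/phiI/Jd/Jt.
pose scal (a : K) : A^c := a%:A.
have scalB : zmod_morphism scal by move=> a b; rewrite /scal scalerBl.
have scalM : monoid_morphism scal.
  split; first exact: scale1r.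
  by move=> a b; rewrite /scal -[RHS]/((b%:A : A) * a%:A) -scalerAl mul1r scalerA mulrC.
pose h1 := GRing.isZmodMorphism.Build K A^c scal scalB.
pose h2 := GRing.isMonoidMorphism.Build K A^c scal scalM.
have [iota iotaE] : exists iota : {rmorphism K -> A^c}, forall a, iota a = scal a.
  pose i : {rmorphism K -> A^c} := HB.pack scal h1 h2.
  by exists i.
(* In the converse ring, [e i * t = t * e (ordS i)] reads with its factors exchanged; reversing the
   vertices restores the direction required by [te]. *)
pose v (j : nat) : 'I_n := rev_ord (Ordinal (ltn_pmod j n_gt0)).
have vS j : ordS (v j.+1) = v j.
  have jS : (j.+1 %% n = (j %% n + 1) %% n)%N by rewrite modnDml addn1.
  apply: val_inj; rewrite /= jS; have := ltn_pmod j n_gt0.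
  move: (j %% n)%N => k kn; have [k1|k1] := ltnP (k + 1) n.
    by rewrite (modn_small k1) modn_small; lia.
  have -> : (k + 1 = n)%N by lia.
  rewrite modnn (_ : n - 1 = n.-1)%N ?prednK // ?modnn; lia.
have v_rev i : v (rev_ord i) = i.
  by apply: val_inj; rewrite /= modn_small; have := ltn_ord i; lia.
have v_eq i j : (v i == v j) = (i == j %[mod n]).
  by rewrite /v (inj_eq rev_ord_inj) -(inj_eq val_inj).
constructor; apply: (@NakayamaRing K A^c n iota d (fun j =>
  phi (e (v j)) : A^c) (phi t : A^c)).
- exact: n_gt0.
- move=> a s; rewrite iotaE -[LHS]/((s : A) * a%:A) -[RHS]/((a%:A : A) * s).
  by rewrite -scalerAr mulr1 -scalerAl mul1r.
- move=> i j; rewrite -[_ * _]/((phi (e (v j)) : A) * phi (e (v i))) -phiM ee.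
  by rewrite eq_sym -v_eq; case: eqP => [->//|_]; rewrite linear0.
- by move=> i; rewrite /v; congr (phi (e (rev_ord _))); apply: val_inj; rewrite /= modnDr.
- by move=> i; apply/eqP => /phiI/IJ; apply: Je.
- apply: (etrans _ phi1); rewrite -e1 linear_sum (reindex_inj rev_ord_inj) /=;
  apply: eq_bigr => i _.
  by rewrite v_rev.
- move=> i; rewrite -[LHS]/((phi (e (v i.+1)) : A) * phi t)
  -[RHS]/((phi t : A) * phi (e (v i))).
  by rewrite -!phiM et vS.
- rewrite -[RHS]td; exact: revrX.
move=> s; have [x <-] := phi_surj s.
apply: (ind (fun x => exists lam : 'I_n -> nat -> K, phi x =
  \sum_(i < n) \sum_(k < d) iota (lam i k) * ((phi t : A^c) ^+ k * (phi (e (v i)) : A^c)))).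
- exists (fun _ _ => 0); rewrite linear0 big1 // => i _; rewrite big1 // => k _.
  by rewrite rmorph0 mul0r.
- move=> y z [lam yE] [mu zE]; exists (fun i k => lam i k + mu i k).
  rewrite linearD yE zE -big_split; apply: eq_bigr => i _ /=; rewrite -big_split.
  by apply: eq_bigr => k _; rewrite /= rmorphD mulrDl.
move=> a i k.
have phiE : phi (a *: (e i * t ^+ k)) = a *: (phi (e i) * phi t ^+ k).
  by rewrite linearZ /= phiM phiX.
have [kd|dk] := ltnP k d; last first.
  exists (fun _ _ => 0); rewrite phiE -(subnK dk) exprD td !mulr0 scaler0.
  by rewrite big1 // => j _; rewrite big1 // => l _; rewrite rmorph0 mul0r.
exists (fun j l => if (j == rev_ord i) && (l == k) then a else 0).
rewrite (bigD1 (rev_ord i)) //= [X in _ + X]big1 => [|j /negbTE ji]; last first.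
  by rewrite big1 // => l _; rewrite ji rmorph0 mul0r.
rewrite addr0 (bigD1 (Ordinal kd)) //= big1 => [|l lk]; last first.
  by rewrite (inj_eq val_inj l (Ordinal kd)) (negbTE lk) andbF rmorph0 mul0r.
rewrite !eqxx addr0 v_rev phiE revrX iotaE.
rewrite -[RHS]/((phi (e i) * phi t ^+ k : A) * a%:A).
by rewrite -scalerAr mulr1.
Qed.

End QuiverRing.

Lemma nakayama_ringP (K : fieldType) (n : nat) (A : falgType K) : nakayama n A ->
  inhabited (nakayama_ring K A^c n).
Proof.
case=> [[n1 qA]|[n0 qA]].
  apply: quiver_nakayama_ring qA => [i j /(congr1 val) /= ij|a|]; last exact: ltnW.
    exact: val_inj.
  by apply: val_inj; rewrite /= modn_small // line_target_subproof.
by apply: quiver_nakayama_ring qA => // i j.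
Qed.

Theorem corollary2p2 (R : realType) (K : fieldType) (n : nat) (A : falgType K)
    (nakA : nakayama n A) (nsiA : ~ selfinjective A) :
  [/\ (sdomdim R A <= (2 * n - 2)%:R%:E)%E,
      (algebra_domdim R A <= (2 * n - 2)%:R%:E / defect R A)%E
    & (n%:R%:E <= algebra_domdim R A)%E -> defect R A = 1%E].
Proof.
have [X] := nakayama_ringP nakA.
have [D DP] := exists_proj_index X.
have defectE : defect R A = iso_classes_card R (@injnonproj A^c) by [].
have domdimE : algebra_domdim R A = domdim R ((A^c)^o : lmodType A^c) by [].
split.
- exact: projnoninj_sum_le DP nsiA.
- have [dN|[q [r [[qle rE r1 qr] _]]]] := domdim_defect_bounds X R nsiA.
    by rewrite domdimE dN leNye.
  have r0 : 0 < r by apply: lt_le_trans r1.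
  rewrite defectE rE inver gt_eqF // lee_pdivlMr // domdimE.
  apply: le_trans (lee_wpmul2r _ qle) _; first by rewrite lee_fin ltW.
  by rewrite -EFinM lee_fin.
have [dN|[q [r [[qle rE r1 qr] rq]]]] := domdim_defect_bounds X R nsiA.
  by rewrite domdimE dN.
move=> nle; rewrite defectE rE rq //.
by have := le_trans nle qle; rewrite lee_fin ler_nat.
Qed.
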